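(* Let $M\subset\mathbb{R}^3$ be a connected, closed (compact, without boundary), smooth embedded surface, regarded as the mm-space $\mathcal{M}$ with extrinsic Euclidean distance and normalized surface area measure, and let $\mathbb{S}^2\subset\mathbb{R}^3$ be the unit sphere regarded in the same way. If $H_{\mathcal{M}}(r)=H_{\mathbb{S}^2}(r)$ for all $r\geq0$, then $M$ is isometric to $\mathbb{S}^2$, i.e. $M$ is a round sphere of radius $1$.
   Context: For an mm-space $\mathcal{X}=(X,d_X,\mu_X)$ (compact metric space with fully supported Borel probability measure), the global distance distribution is $H_{\mathcal{X}}(r)=\mu_X\otimes\mu_X(\{(x,x')\in X\times X: d_X(x,x')\le r\})$, $r\ge0$. An embedded hypersurface $M\subset\mathbb{R}^{d+1}$ is regarded as an mm-space with $d_M$ the restriction of the Euclidean distance and $\mu_M$ the Riemannian (surface) volume normalized to total mass one. *)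

(* Defs.v *)
From HB Require Import structures.
From mathcomp Require Import all_boot all_order all_algebra.
From mathcomp Require Import all_classical all_reals all_analysis.
Set Implicit Arguments. Unset Strict Implicit. Unset Printing Implicit Defensive.
Import Order.TTheory GRing.Theory Num.Theory.
Import numFieldNormedType.Exports.
Local Open Scope classical_set_scope.
Local Open Scope ring_scope.

Section Defs.
Variable R : realType.

(* Points of R^3, as triples ((x, y), z); product topology = Euclidean topology,
   product sigma-algebra = Borel sigma-algebra of R^3. *)
Definition pt := (R * R * R)%type.

Definition origin : pt := (0, 0, 0).

Definition dist3 (p q : pt) : R :=
  Num.sqrt ((p.1.1 - q.1.1) ^+ 2 + (p.1.2 - q.1.2) ^+ 2 + (p.2 - q.2) ^+ 2).

Definition sphere2 : set pt := [set p | dist3 p origin = 1].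

Definition pd1 (f : R * R -> R) : R * R -> R :=
  fun u => derive1 (fun t => f (t, u.2)) u.1.
Definition pd2 (f : R * R -> R) : R * R -> R :=
  fun u => derive1 (fun t => f (u.1, t)) u.2.

Fixpoint Cn_on (n : nat) (U : set (R * R)) (f : R * R -> R) : Prop :=
  match n with
  | 0%N => forall u, U u -> {for u, continuous f}
  | n'.+1 =>
      (forall u, U u -> derivable (fun t => f (t, u.2)) u.1 1 /\
                        derivable (fun t => f (u.1, t)) u.2 1) /\
      Cn_on n' U f /\ Cn_on n' U (pd1 f) /\ Cn_on n' U (pd2 f)
  end.

Definition smooth_on (U : set (R * R)) (f : R * R -> R) : Prop :=
  forall n, Cn_on n U f.

Definition graph (k : 'I_3) (f : R * R -> R) (u : R * R) : pt :=
  if val k == 0%N then (f u, u.1, u.2)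
  else if val k == 1%N then (u.1, f u, u.2)
  else (u.1, u.2, f u).

Definition is_chart (M : set pt) (k : 'I_3) (U : set (R * R))
    (f : R * R -> R) (W : set pt) : Prop :=
  open U /\ smooth_on U f /\ open W /\ M `&` W = graph k f @` U.

Definition closed_smooth_surface (M : set pt) : Prop :=
  M !=set0 /\ compact M /\ connected M /\
  forall p, M p -> exists k U f W, W p /\ is_chart M k U f W.

(* Riemannian area density of the graph of f: sqrt(det g) with
   g = I + grad f (grad f)^T *)
Definition area_density (f : R * R -> R) (u : R * R) : R :=
  Num.sqrt (1 + (pd1 f u) ^+ 2 + (pd2 f u) ^+ 2).

Definition lebesgue2 := (@lebesgue_measure R \x @lebesgue_measure R)%E.

(* mu is the (unnormalized) Riemannian surface measure of M, viewed as a Borel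
   measure on R^3 carried by M: it vanishes off M, and in every graph chart it
   is given by the Riemannian area element. *)
Definition surface_measure (M : set pt) (mu : {measure set pt -> \bar R}) : Prop :=
  mu (~` M) = 0%E /\
  forall k U f W, is_chart M k U f W ->
  forall A : set pt, measurable A -> A `<=` M `&` W ->
    mu A = (\int[lebesgue2]_(u in U `&` (graph k f @^-1` A))
              (area_density f u)%:E)%E.

Definition normalized (mu : set pt -> \bar R) : set pt -> \bar R :=
  fun A => (mu A * ((fine (mu setT))^-1)%:E)%E.

Definition global_dist_distr (muX : set pt -> \bar R) (r : R) : \bar R :=
  (muX \x muX)%E [set xx | dist3 xx.1 xx.2 <= r].

End Defs.

(* Main.v *)
(** The second and fourth moments of the distance determine the sphere. Let x, y be
    independent points of M, let E denote expectation with respect to the normalized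
    area, translate M so that E x = 0, and put a = |x|^2 and S = E (x x^T). Expanding
    |x - y|^2 = |x|^2 + |y|^2 - 2 <x, y> gives
      E |x - y|^2 = 2 E a   and   E |x - y|^4 = 2 E a^2 + 2 (E a)^2 + 4 |S|^2,
    where |S| is the Frobenius norm. Since E a^2 >= (E a)^2 and |S|^2 >= (tr S)^2 / 3
    = (E a)^2 / 3, the fourth moment is at least (16/3) (E a)^2. By symmetry the unit
    sphere has E a = 1 and S = I/3, so it attains equality; the equality of distance
    distributions therefore forces a = 1 almost everywhere on M, hence everywhere,
    because the area measure charges every nonempty relatively open subset of M. Thus M
    is a compact subset of a unit sphere which is also relatively open in it, being
    locally a graph, and it is the whole sphere by connectedness. *)
Require Import Defs.
From HB Require Import structures.
From mathcomp Require Import all_boot all_order all_algebra.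
From mathcomp Require Import all_classical all_reals all_analysis.
From mathcomp Require Import measurable_realfun ring lra.
Set Implicit Arguments. Unset Strict Implicit. Unset Printing Implicit Defensive.
Import Order.TTheory GRing.Theory Num.Theory.
Import numFieldNormedType.Exports.
Local Open Scope classical_set_scope.
Local Open Scope ring_scope.

(** * Borel measurability of open sets in the plane and in space *)

Definition has_countable_base (T : topologicalType) (P : set T -> Prop) :=
  exists B : nat -> set T, (forall n, P (B n)) /\
    forall A x, open A -> A x -> exists n, B n x /\ B n `<=` A.

(** The sigma-algebra on the products is generated by measurable rectangles, so measurability of
    open sets has to come from a countable base. Taking [P] to be measurability, an open set is a
    countable union of basic sets. *)
Lemma countable_base_open (T : topologicalType) (P : set T -> Prop) (A : set T) :
  @has_countable_base T P -> P set0 ->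
  (forall F : nat -> set T, (forall n, P (F n)) -> P (\bigcup_n F n)) ->
  open A -> P A.
Proof.
move=> [B [PB hB]] P0 PU oA.
(* Basic sets not contained in [A] are replaced by the empty set, so that the union can run over all
   indices. *)
pose F n := if `[< B n `<=` A >] then B n else set0.
have -> : A = \bigcup_n F n.
  apply/seteqP; split => [x Ax|x [n _]]; last first.
    by rewrite /F; case: asboolP => [BA /BA|].
  have [n [Bx BA]] := hB A x oA Ax.
  by exists n => //; rewrite /F asboolT.
by apply: PU => n; rewrite /F; case: asboolP.
Qed.

Lemma countable_base_prod (T1 T2 : topologicalType) (P1 : set T1 -> Prop)
    (P2 : set T2 -> Prop) (P : set (T1 * T2) -> Prop) :
  (forall A B, P1 A -> P2 B -> P (A `*` B)) ->
  @has_countable_base T1 P1 -> @has_countable_base T2 P2 ->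
  @has_countable_base (T1 * T2)%type P.
Proof.
move=> PX [B1 [PB1 h1]] [B2 [PB2 h2]].
(* Numbers that code no pair default to (0, 0); this only repeats a basic set in the enumeration. *)
pose c n : nat * nat := odflt (0%N, 0%N) (unpickle n).
exists (fun n => B1 (c n).1 `*` B2 (c n).2); split=> [n|A [x y] oA Axy].
  exact: PX.
have : nbhs (x, y) A by exact: open_nbhs_nbhs.
case=> -[U V] /= [Ux Vy] UVA.
have [i [Bix BiU]] := h1 _ _ (open_interior U) Ux.
have [j [Bjy BjV]] := h2 _ _ (open_interior V) Vy.
exists (pickle (i, j)); rewrite /c pickleK /=; split=> // -[a b] [/= Ba Bb].
apply: UVA; split=> /=; first exact: interior_subset (BiU _ Ba).
exact: interior_subset (BjV _ Bb).
Qed.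

Lemma countable_base_real (R : realType) :
  @has_countable_base R (@measurable _ R).
Proof.
pose c n : rat * nat := odflt (0, 0%N) (unpickle n).
exists (fun n => ball (ratr (c n).1 : R) ((c n).2.+1%:R^-1)); split=> [n|A x oA Ax].
  exact: measurable_ball.
have /nbhs_ballP[e /= e0 eA] : nbhs x A by exact: open_nbhs_nbhs.
have e20 : 0 < e / 2 by rewrite divr_gt0.
(* The radius d = 1 / (k + 1) is at most e / 2: a ball of radius d that contains [x] then lies
   within e of [x], and a rational center is available within d of [x]. *)
have [k /ltW ke] := ltr_add_invr (ltac:(by []) : 0 < e / 2).
rewrite add0r in ke.
set d : R := k.+1%:R^-1 in ke.
have d0 : 0 < d by rewrite invr_gt0.
have /rat_in_itvoo[q /itvP qx] : x - d < x + d by lra.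
exists (pickle (q, k)); rewrite /c pickleK /= -/d.
have xq : ball (ratr q : R) d x.
  have q1 : x - d < ratr q by rewrite qx.
  have q2 : ratr q < x + d by rewrite qx.
  by rewrite /ball /= ltr_norml; apply/andP; split; lra.
split=> // y qy; apply: eA.
have := ball_triangle (ball_sym xq) qy.
by apply: le_ball; lra.
Qed.

Lemma open_pair_measurable (R : realType) (A : set (R * R)) :
  open A -> measurable A.
Proof.
apply: (@countable_base_open (R * R)%type (@measurable _ (R * R)%type)).
- apply: (@countable_base_prod R R (@measurable _ R) (@measurable _ R) (@measurable _ (R * R)%type)); last 2 first.
  + exact: countable_base_real.
  + exact: countable_base_real.
  by move=> B C mB mC; exact: measurableX.
- exact: measurable0.
- by move=> F mF; exact: bigcupT_measurable.
Qed.

Lemma open_pt_measurable (R : realType) (A : set (pt R)) : open A -> measurable A.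
Proof.
apply: (@countable_base_open (R * R * R)%type (@measurable _ (R * R * R)%type)).
- apply: (@countable_base_prod (R * R)%type R (@measurable _ (R * R)%type) (@measurable _ R) (@measurable _ (R * R * R)%type)).
  + by move=> B C mB mC; exact: measurableX.
  + apply: (@countable_base_prod R R (@measurable _ R) (@measurable _ R) (@measurable _ (R * R)%type)).
    * by move=> B C mB mC; exact: measurableX.
    * exact: countable_base_real.
    * exact: countable_base_real.
  + exact: countable_base_real.
- exact: measurable0.
- by move=> F mF; exact: bigcupT_measurable.
Qed.

Lemma closed_pt_measurable (R : realType) (A : set (pt R)) : closed A -> measurable A.
Proof.
by move=> cA; rewrite -(setCK A); apply: measurableC; apply: open_pt_measurable;
  rewrite openC.
Qed.

Lemma continuous_pt_measurable (R : realType) (f : pt R -> R) :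
  continuous f -> measurable_fun setT f.
Proof.
move=> cf; apply: (measurability _ (RGenOInfty.measurableE R)) => _ [_ [x ->] <-].
rewrite setTI; apply: open_pt_measurable.
by apply: open_comp => // y _; exact: cf.
Qed.

(** * Graph charts and their area density *)

Definition chart_proj (R : realType) (k : 'I_3) (p : pt R) : R * R :=
  if val k == 0%N then (p.1.2, p.2)
  else if val k == 1%N then (p.1.1, p.2)
  else (p.1.1, p.1.2).

Lemma graphK (R : realType) (k : 'I_3) (f : R * R -> R) :
  cancel (graph k f) (@chart_proj R k).
Proof. by move=> [x y]; rewrite /graph /chart_proj; case: k => -[|[|[|]]]. Qed.

Lemma cvg_pair_nbhs (S T U : topologicalType) (f : S -> T) (g : S -> U) (x : S) (a : T) (b : U) :
  f s @[s --> x] --> a -> g s @[s --> x] --> b ->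
  (f s, g s) @[s --> x] --> (a, b).
Proof. by move=> cf cg; exact: (cvg_pair cf cg). Qed.

Lemma chart_proj_continuous (R : realType) (k : 'I_3) : continuous (@chart_proj R k).
Proof.
have c2 : continuous (fun p : pt R => p.2) by move=> p; exact: cvg_snd.
have c1 : continuous (fun p : pt R => p.1) by move=> p; exact: cvg_fst.
have c12 : continuous (fun p : pt R => p.1.2).
  by move=> p; apply: (@continuous_comp _ _ _ fst snd); [exact: c1|exact: cvg_snd].
have c11 : continuous (fun p : pt R => p.1.1).
  by move=> p; apply: (@continuous_comp _ _ _ fst fst); [exact: c1|exact: cvg_fst].
move=> p; rewrite /chart_proj; case: k => -[|[|[|//]]] ? /=.
- exact: cvg_pair_nbhs (c12 p) (c2 p).
- exact: cvg_pair_nbhs (c11 p) (c2 p).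
- exact: cvg_pair_nbhs (c11 p) (c12 p).
Qed.

Lemma graph_continuous (R : realType) (k : 'I_3) (f : R * R -> R) (u : R * R) :
  {for u, continuous f} -> {for u, continuous (graph k f)}.
Proof.
move=> cf.
have c1 : (fun v : R * R => v.1) @ u --> u.1 by exact: cvg_fst.
have c2 : (fun v : R * R => v.2) @ u --> u.2 by exact: cvg_snd.
rewrite /graph /prop_for /continuous_at; case: k => -[|[|[|//]]] ? /=.
- exact: cvg_pair_nbhs (cvg_pair_nbhs cf c1) c2.
- exact: cvg_pair_nbhs (cvg_pair_nbhs c1 cf) c2.
- exact: cvg_pair_nbhs (cvg_pair_nbhs c1 c2) cf.
Qed.

Lemma continuous_on_open_measurable (R : realType) (U : set (R * R)) (f : R * R -> R) :
  open U -> (forall u, U u -> {for u, continuous f}) -> measurable_fun U f.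
Proof.
move=> oU cf; apply: (measurability _ (RGenOInfty.measurableE R)).
move=> _ [_ [x ->] <-]; apply: open_pair_measurable.
rewrite openE => u [Uu /= fux].
apply: filterI; first exact: open_nbhs_nbhs.
by apply: (cf u Uu); exact: open_nbhs_nbhs.
Qed.

Lemma area_density_continuous (R : realType) (U : set (R * R)) (f : R * R -> R) u :
  smooth_on U f -> U u -> {for u, continuous (area_density f)}.
Proof.
move=> sf Uu; have [_ [_ [c1 c2]]] := sf 1%N.
apply: (@continuous_comp _ _ _ _ Num.sqrt); last exact: sqrt_continuous.
apply: cvgD; first apply: cvgD; first exact: cvg_cst.
  by rewrite expr2; under eq_fun do rewrite expr2; apply: cvgM; exact: c1.
by rewrite expr2; under eq_fun do rewrite expr2; apply: cvgM; exact: c2.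
Qed.

Lemma area_density_measurable (R : realType) (U B : set (R * R)) (f : R * R -> R) :
  smooth_on U f -> open B -> B `<=` U ->
  measurable_fun B (fun u => (area_density f u)%:E).
Proof.
move=> sf oB BU; apply/measurable_EFinP; apply: continuous_on_open_measurable => //.
by move=> u /BU; exact: area_density_continuous.
Qed.

Lemma area_density_ge1 (R : realType) (f : R * R -> R) u : 1 <= area_density f u.
Proof.
rewrite -[leLHS]sqrtr1 ler_wsqrtr// -addrA lerDl addr_ge0//; exact: sqr_ge0.
Qed.

(** * Coordinate boxes and the mass of a surface: positive on open sets, finite in total *)

Definition box (R : realType) (u : R * R) (e : R) : set (R * R) :=
  ball u.1 e `*` ball u.2 e.

Lemma box_center (R : realType) (u : R * R) (e : R) : 0 < e -> box u e u.
Proof. by move=> e0; split; exact: ballxx. Qed.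

Lemma box_open (R : realType) (u : R * R) (e : R) : open (box u e).
Proof.
rewrite openE => v [v1 v2]; exists (ball u.1 e, ball u.2 e) => //=.
by split; apply: open_nbhs_nbhs; split => //; exact: ball_open.
Qed.

Lemma nbhs_box (R : realType) (u : R * R) (N : set (R * R)) :
  nbhs u N -> exists2 e : R, 0 < e & box u e `<=` N.
Proof.
move=> /nbhs_ballP[e /= e0 eN]; exists e => // v [v1 v2]; exact: eN.
Qed.

Lemma lebesgue2_box (R : realType) (u : R * R) (e : R) : 0 < e ->
  lebesgue2 (box u e) = ((e *+ 2) * (e *+ 2))%:E.
Proof.
move=> e0; rewrite /lebesgue2 /box product_measure1E; [|exact: measurable_ball..].
by rewrite EFinM; congr (_ * _)%E; apply: lebesgue_measure_ball; exact: ltW.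
Qed.

Lemma integral_box_cst (R : realType) (u : R * R) (e c : R) : 0 < e ->
  (\int[@lebesgue2 R]_(v in box u e) c%:E = (c * ((e *+ 2) * (e *+ 2)))%:E)%E.
Proof.
move=> e0; rewrite EFinM -(lebesgue2_box u e0) /lebesgue2 integral_cst//.
by apply: open_pair_measurable; exact: box_open.
Qed.

Section charts.
Context (R : realType) (M : set (pt R)) (mu : {measure set pt R -> \bar R}).
Hypothesis cM : closed M.
Hypothesis muM : surface_measure M mu.

(** The set measured is the part of the graph lying over [B]; since [chart_proj] inverts the graph
    map, the parameter domain in the chart formula is exactly [B]. *)
Lemma chart_box_mass k U f W (B : set (R * R)) :
  is_chart M k U f W -> open B -> B `<=` U ->
  mu (M `&` W `&` chart_proj k @^-1` B) =
    (\int[@lebesgue2 R]_(u in B) (area_density f u)%:E)%E.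
Proof.
move=> ch oB BU; have [oU [sf [oW MW]]] := ch.
rewrite (muM.2 k U f W ch); first last.
- by move=> p [].
- apply: measurableI; last first.
    apply: open_pt_measurable; apply: open_comp => // ? _.
    exact: chart_proj_continuous.
  by apply: measurableI; [exact: closed_pt_measurable|exact: open_pt_measurable].
congr integral; apply/seteqP; split => [u [Uu [/= _]]|u Bu].
  by rewrite /preimage/= graphK.
split; first exact: BU.
have MWu : (M `&` W) (graph k f u) by rewrite MW; exists u => //; exact: BU.
by rewrite /preimage/= graphK.
Qed.


Hypothesis smM : forall p, M p -> exists k U f W, W p /\ is_chart M k U f W.

(** A small box around the parameter of [p] is carried into [V] by the chart, and the area density
    is at least 1, so the mass is at least the Lebesgue area of the box. *)
Lemma open_mass_gt0 p (V : set (pt R)) : M p -> open V -> V p -> (0 < mu V)%E.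
Proof.
move=> Mp oV Vp; have [k [U [f [W [Wp ch]]]]] := smM Mp.
have [oU [sf [oW MW]]] := ch.
have : (M `&` W) p by [].
rewrite MW => -[u Uu gup].
have [e e0 eN] : exists2 e : R, 0 < e & box u e `<=` U `&` graph k f @^-1` V.
  apply: nbhs_box; apply: filterI; first exact: open_nbhs_nbhs.
  apply: (graph_continuous (k := k) (sf 0%N u Uu)); rewrite gup.
  exact: open_nbhs_nbhs.
have BU : box u e `<=` U by move=> v /eN[].
have mB : measurable (box u e) by apply: open_pair_measurable; exact: box_open.
have := chart_box_mass ch (@box_open _ u e) BU.
set A := (X in mu X) => muA.
apply: (@lt_le_trans _ _ (mu A)); last first.
  apply: le_measure; rewrite ?inE.
  - apply: measurableI; last first.
      apply: open_pt_measurable; apply: open_comp; last exact: box_open.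
      by move=> ? _; exact: chart_proj_continuous.
    by apply: measurableI; [exact: closed_pt_measurable|exact: open_pt_measurable].
  - exact: open_pt_measurable.
  move=> q [[Mq Wq] Bq]; have : (M `&` W) q by [].
  rewrite MW => -[v Uv gv].
  by move: Bq; rewrite -gv /preimage/= graphK => /eN[].
rewrite muA; apply: (@lt_le_trans _ _ (\int[@lebesgue2 R]_(u in box u e) 1%:E)%E).
  by rewrite integral_box_cst// lte_fin mul1r mulr_gt0// mulrn_wgt0.
rewrite /lebesgue2; apply: ge0_le_integral => //.
- exact: area_density_measurable sf (@box_open _ u e) BU.
- by move=> v _; rewrite lee_fin area_density_ge1.
Qed.

Lemma locally_finite_mass p : M p ->
  exists V, [/\ open V, V p & (mu (M `&` V) < +oo)%E].
Proof.
move=> Mp; have [k [U [f [W [Wp ch]]]]] := smM Mp.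
have [oU [sf [oW MW]]] := ch.
have : (M `&` W) p by [].
rewrite MW => -[u Uu gup].
(* Any bound strictly above the density at [u] serves: by continuity it persists on a small box,
   whose mass is then at most [C] times its area. *)
pose C := area_density f u + 1.
have [e e0 eN] : exists2 e : R, 0 < e & box u e `<=` U `&` [set v | area_density f v < C].
  apply: nbhs_box; apply: filterI; first exact: open_nbhs_nbhs.
  apply: (area_density_continuous sf Uu (t := [set x | x < C])).
  by apply: open_nbhs_nbhs; split; [exact: open_lt|rewrite /C /= ltrDl].
have BU : box u e `<=` U by move=> v /eN[].
have mB : measurable (box u e) by apply: open_pair_measurable; exact: box_open.
exists (W `&` chart_proj k @^-1` (box u e)); split.
- apply: openI => //; apply: open_comp; last exact: box_open.
  by move=> ? _; exact: chart_proj_continuous.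
- by split => //; rewrite -gup /= graphK; exact: box_center.
rewrite setIA (chart_box_mass ch (@box_open _ u e) BU).
apply: (@le_lt_trans _ _ (\int[@lebesgue2 R]_(u in box u e) C%:E)%E).
  rewrite /lebesgue2; apply: ge0_le_integral => //.
  - by move=> v _; rewrite lee_fin sqrtr_ge0.
  - exact: area_density_measurable sf (@box_open _ u e) BU.
  - by move=> v /eN[_ /ltW]; rewrite lee_fin.
by rewrite integral_box_cst// ltry.
Qed.

Lemma compact_finite_mass : compact M -> (mu setT < +oo)%E.
Proof.
move=> kM.
have mM : measurable M by exact: closed_pt_measurable.
have -> : mu setT = mu M.
  have -> : [set: pt R] = ~` M `|` M by rewrite setvU.
  rewrite measureU ?setICl//; last exact: measurableC.
  by rewrite [X in (X + _)%E](_ : _ = 0%E) ?add0e//; exact: muM.1.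
(* Compactness is used through the filter of supersets of sets of finite mass. *)
pose F := [set S : set (set (pt R)) | exists A0,
  [/\ measurable A0, (mu A0 < +oo)%E & forall A, A0 `<=` A -> S A]].
have FF : Filter F.
  split; first by exists set0; rewrite measure0.
    move=> S T [A [mA fA hA]] [B [mB fB hB]]; exists (A `|` B); split.
    - exact: measurableU.
    - by apply: le_lt_trans (measureU2 mu mA mB) _; rewrite lte_add_pinfty.
    - move=> C ABC; split; [apply: hA|apply: hB] => x ?; apply: ABC; [by left|by right].
  by move=> S T ST [A [mA fA hA]]; exists A; split=> // C /hA /ST.
(* The covering form of compactness provides a finite-mass set [A] all of whose supersets contain
   [M]; taking [A] itself as superset bounds the mass of [M]. *)
move/compact_near_coveringP: kM => /(_ _ F (fun A p => M p -> A p) FF) [].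
  move=> p Mp; have [V [oV Vp fV]] := locally_finite_mass Mp.
  exists (V, [set A | M `&` V `<=` A]); last by move=> [q A] /= [Vq MVA] Mq; exact: MVA.
  split; first exact: open_nbhs_nbhs.
  exists (M `&` V); split => //; apply: measurableI => //; exact: open_pt_measurable.
move=> A [mA fA hA]; apply: le_lt_trans fA; apply: le_measure; rewrite ?inE//.
by move=> p Mp; exact: (hA A (@subset_refl _ A)).
Qed.

End charts.

(** * Surfaces contained in a unit sphere *)

Lemma pt_hausdorff (R : realType) : hausdorff_space (pt R).
Proof. exact: norm_hausdorff. Qed.

Definition sphere (R : realType) (c : pt R) : set (pt R) := [set p | dist3 p c = 1].

Definition chart_height (R : realType) (k : 'I_3) (p : pt R) : R :=
  if val k == 0%N then p.1.1 else if val k == 1%N then p.1.2 else p.2.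

Lemma chart_heightE (R : realType) (k : 'I_3) f (u : R * R) :
  chart_height k (graph k f u) = f u.
Proof. by rewrite /graph /chart_height; case: k => -[|[|[|]]]. Qed.

Lemma chart_coordK (R : realType) (k : 'I_3) f (p : pt R) :
  f (chart_proj k p) = chart_height k p -> graph k f (chart_proj k p) = p.
Proof.
rewrite /graph /chart_height /chart_proj; case: p => -[x y] z.
by case: k => -[|[|[|]]] //= _ ->.
Qed.

Lemma chart_height_continuous (R : realType) (k : 'I_3) : continuous (@chart_height R k).
Proof.
move=> p; rewrite /chart_height; case: k => -[|[|[|//]]] ? /=.
- by apply: (@continuous_comp _ _ _ fst fst); exact: cvg_fst.
- by apply: (@continuous_comp _ _ _ fst snd); [exact: cvg_fst|exact: cvg_snd].
- exact: cvg_snd.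
Qed.

Lemma sphereE (R : realType) (c p : pt R) :
  sphere c p <->
  (p.1.1 - c.1.1) ^+ 2 + (p.1.2 - c.1.2) ^+ 2 + (p.2 - c.2) ^+ 2 = 1.
Proof.
rewrite /sphere /dist3 /=; split=> [h|->]; last by rewrite sqrtr1.
by rewrite -[LHS]sqr_sqrtr ?h ?expr1n// !addr_ge0// sqr_ge0.
Qed.

Lemma sphere_chartE (R : realType) (k : 'I_3) (c p : pt R) :
  sphere c p <->
  (chart_height k p - chart_height k c) ^+ 2
  + ((chart_proj k p).1 - (chart_proj k c).1) ^+ 2
  + ((chart_proj k p).2 - (chart_proj k c).2) ^+ 2 = 1.
Proof.
rewrite sphereE /chart_height /chart_proj.
by case: k => -[|[|[|//]]] ? /=; split => <-; ring.
Qed.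

(* A graph cannot cross the equator orthogonal to its axis, where it would leave the
   sphere; off the equator the sphere is itself a graph with the same sign. *)
Lemma chart_in_sphere_open (R : realType) (M : set (pt R)) (c p : pt R) k U f W :
  M `<=` sphere c -> is_chart M k U f W -> M p -> W p ->
  exists V, [/\ open V, V p & sphere c `&` V `<=` M].
Proof.
move=> MS ch Mp Wp; have [oU [sf [oW MW]]] := ch.
have gM u : U u -> (M `&` W) (graph k f u) by rewrite MW => Uu; exists u.
set h := chart_height k c; set d := chart_proj k c.
have eqf u : U u -> (f u - h) ^+ 2 + (u.1 - d.1) ^+ 2 + (u.2 - d.2) ^+ 2 = 1.
  by move=> /gM[/MS + _]; rewrite (sphere_chartE k) chart_heightE graphK.
have : (M `&` W) p by [].
rewrite MW => -[u Uu gup].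
have fuh : f u - h != 0.
  apply/eqP => fuh0.
  have [e e0 eU] := nbhs_box (open_nbhs_nbhs (conj oU Uu)).
  have := eqf _ Uu; rewrite fuh0 => u1.
  (* Moving the base point radially away from [d] by the factor 1 + t shifts each coordinate by at
     most t < e, so it stays in [U]; its squared distance to [d] becomes (1 + t)^2 > 1, against
     [eqf]. *)
  pose t := e / 2.
  have t0 : 0 < t by rewrite divr_gt0.
  have te : t < e by rewrite /t; lra.
  have small x y : 0 ^+ 2 + x ^+ 2 + y ^+ 2 = 1 -> `|t * x| < e.
    move=> xy; have x1 : `|x| <= 1.
      by rewrite -(@expr_le1 _ 2)// real_normK ?num_real//; have := sqr_ge0 y; lra.
    rewrite normrM gtr0_norm//; nra.
  have Uv : U (u.1 + t * (u.1 - d.1), u.2 + t * (u.2 - d.2)).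
    apply: eU; split; rewrite /ball /= opprD addNKr normrN.
      exact: small u1.
    by apply: (small _ (u.1 - d.1)); rewrite -u1; ring.
  have /= := eqf _ Uv.
  have := sqr_ge0 (f (u.1 + t * (u.1 - d.1), u.2 + t * (u.2 - d.2)) - h).
  set z := _ ^+ 2 => z0.
  have -> : z + (u.1 + t * (u.1 - d.1) - d.1) ^+ 2 + (u.2 + t * (u.2 - d.2) - d.2) ^+ 2
    = z + (1 + t) ^+ 2 * (0 ^+ 2 + (u.1 - d.1) ^+ 2 + (u.2 - d.2) ^+ 2) by ring.
  rewrite u1; nra.
set s := f u - h in fuh *.
have oV1 : open [set q : pt R | 0 < (chart_height k q - h) * s].
  apply: (open_comp (f := fun q : pt R => (chart_height k q - h) * s) (D := [set x | 0 < x])).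
    move=> q _; apply: cvgM; last exact: cvg_cst.
    by apply: cvgB; [exact: chart_height_continuous|exact: cvg_cst].
  exact: open_gt.
have oV2 : open (U `&` [set v | 0 < (f v - h) * s]).
  rewrite openE => v [Uv /= fv]; apply: filterI; first exact: open_nbhs_nbhs.
  have cv : (fun w => (f w - h) * s) @ v --> (f v - h) * s.
    apply: cvgM; last exact: cvg_cst.
    by apply: cvgB; [exact: (sf 0%N)|exact: cvg_cst].
  by apply: (cv [set x | 0 < x]); apply: open_nbhs_nbhs; split; first exact: open_gt.
exists ([set q : pt R | 0 < (chart_height k q - h) * s] `&`
  chart_proj k @^-1` (U `&` [set v | 0 < (f v - h) * s])); split.
- apply: openI => //; apply: open_comp => // ? _; exact: chart_proj_continuous.
- have s2 : 0 < s * s by rewrite -expr2 exprn_even_gt0.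
  by rewrite -gup /setI/= chart_heightE graphK.
move=> q [Sq [/= hq [Uq fq]]].
have := eqf _ Uq; have := (sphere_chartE k c q).1 Sq; rewrite -/h -/d.
move: hq fq; set a := chart_height k q - h; set b := f (chart_proj k q) - h.
move=> /= as0 bs0 ea eb.
(* Both heights have the same square. The case b = - a is excluded because [a * s] and [b * s] are
   both positive. *)
have ab : b = a.
  have : (b - a) * (b + a) = 0 by rewrite -subr_sqr; lra.
  move/eqP; rewrite mulf_eq0 subr_eq0 => /orP[/eqP//|/eqP ba].
  suff : (b + a) * s = 0 by rewrite mulrDl; lra.
  by rewrite ba mul0r.
rewrite -(@chart_coordK _ k f q); first by have [] := gM _ Uq.
by move/(congr1 (fun x => x + h)): ab; rewrite !subrK.
Qed.

(* Normalized convex combinations of two non-antipodal points stay on the sphere. *)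
Lemma sphere_arc (R : realType) (c p q : pt R) : sphere c p -> sphere c q ->
  (p.1.1 - c.1.1) * (q.1.1 - c.1.1) + (p.1.2 - c.1.2) * (q.1.2 - c.1.2)
  + (p.2 - c.2) * (q.2 - c.2) != -1 ->
  exists B : set (pt R), [/\ connected B, B `<=` sphere c, B p & B q].
Proof.
move=> /sphereE Sp /sphereE Sq.
(* [N t] is the squared distance from [c] to the point at parameter [t] of the chord; [gam] projects
   the chord radially onto the sphere. *)
pose N t := ((1 - t) * (p.1.1 - c.1.1) + t * (q.1.1 - c.1.1)) ^+ 2
  + ((1 - t) * (p.1.2 - c.1.2) + t * (q.1.2 - c.1.2)) ^+ 2
  + ((1 - t) * (p.2 - c.2) + t * (q.2 - c.2)) ^+ 2.
pose g (x y z : R) t := z + ((1 - t) * (x - z) + t * (y - z)) / Num.sqrt (N t).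
pose gam t : pt R :=
  (g p.1.1 q.1.1 c.1.1 t, g p.1.2 q.1.2 c.1.2 t, g p.2 q.2 c.2 t).
have N0 : N 0 = 1 by rewrite -[RHS]Sp /N; ring.
have N1 : N 1 = 1 by rewrite -[RHS]Sq /N; ring.
set D := (X in X != -1) => Dn1.
have D1 : -1 < D.
  rewrite lt_neqAle eq_sym Dn1 /=.
  have := sqr_ge0 ((p.1.1 - c.1.1) + (q.1.1 - c.1.1)).
  have := sqr_ge0 ((p.1.2 - c.1.2) + (q.1.2 - c.1.2)).
  have := sqr_ge0 ((p.2 - c.2) + (q.2 - c.2)).
  move: Sp Sq; rewrite /D; move: (p.1.1 - _) (p.1.2 - _) (p.2 - _).
  by move: (q.1.1 - _) (q.1.2 - _) (q.2 - _) => b1 b2 b3 a1 a2 a3; rewrite !sqrrD => *; lra.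
have NE t : N t = 1 - 2 * (t * (1 - t)) * (1 - D).
  rewrite (_ : N t = (1 - t) ^+ 2 * ((p.1.1 - c.1.1) ^+ 2 + (p.1.2 - c.1.2) ^+ 2 + (p.2 - c.2) ^+ 2)
    + t ^+ 2 * ((q.1.1 - c.1.1) ^+ 2 + (q.1.2 - c.1.2) ^+ 2 + (q.2 - c.2) ^+ 2)
    + 2 * (t * (1 - t)) * D); last by rewrite /N /D; ring.
  by rewrite Sp Sq; ring.
(* With x = t (1 - t), N t = (1 - 4 x) + 2 x (1 + D). Both terms are nonnegative as 0 <= x <= 1/4,
   and where the first vanishes, at x = 1/4, the second is positive. *)
have Npos t : 0 <= t <= 1 -> 0 < N t.
  move=> /andP[t0 t1]; rewrite NE.
  have t4 := sqr_ge0 (t - 2^-1).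
  have : 0 <= t * (1 - t) by rewrite mulr_ge0// subr_ge0.
  have : t * (1 - t) <= 4^-1 by move: t4; rewrite sqrrB exprVn; lra.
  move: (t * (1 - t)) => x x4 x0.
  have : 0 <= x * (1 + D) by rewrite mulr_ge0//; lra.
  by move: x4; rewrite le_eqVlt => /orP[/eqP ->|]; lra.
have cN : continuous N.
  have cc (a b : R) : continuous (fun t : R => ((1 - t) * a + t * b) ^+ 2).
    move=> t; have cl : (fun t : R => (1 - t) * a + t * b) @ t --> (1 - t) * a + t * b.
      apply: cvgD; apply: cvgM; try exact: cvg_cst; try exact: cvg_id.
      by apply: cvgB; [exact: cvg_cst|exact: cvg_id].
    exact: (cvgM cl cl).
  by move=> t; apply: cvgD; [apply: cvgD|]; exact: cc.
have cg x y z t : 0 < N t -> g x y z s @[s --> t] --> g x y z t.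
  move=> Nt; apply: cvgD; first exact: cvg_cst.
  apply: cvgM; last first.
    apply: cvgV; first by rewrite gt_eqF// sqrtr_gt0.
    by apply: continuous_comp; [exact: cN|exact: sqrt_continuous].
  apply: cvgD; apply: cvgM; try exact: cvg_cst; try exact: cvg_id.
  by apply: cvgB; [exact: cvg_cst|exact: cvg_id].
exists (gam @` `[0, 1]%classic); split.
- suff cgam : {within `[0, 1]%classic, continuous gam}.
    exact: (connected_continuous_connected (@segment_connected R 0 1) cgam).
  apply: continuous_in_subspaceT => t; rewrite inE /= in_itv/= => /Npos Nt.
  exact: cvg_pair_nbhs (cvg_pair_nbhs (cg _ _ _ _ Nt) (cg _ _ _ _ Nt)) (cg _ _ _ _ Nt).
- move=> _ [t t01 <-]; have Nt : 0 < N t by apply: Npos; move: t01; rewrite /= in_itv.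
  apply/sphereE => /=.
  rewrite /g !(addrC _ (_ / _)) !addrK !expr_div_n -!mulrDl sqr_sqrtr ?ltW//.
  by rewrite divff// gt_eqF.
- exists 0; first by rewrite /= in_itv/= lexx ler01.
  rewrite /gam /g N0 sqrtr1 !subr0 !mul0r !mul1r !addr0 !divr1 !(addrC _ (_ - _)) !subrK.
  by case: p {Sp N N0 N1 g gam D Dn1 D1 NE Npos cN cg} => -[].
- exists 1; first by rewrite /= in_itv/= lexx ler01.
  rewrite /gam /g N1 sqrtr1 !subrr !mul0r !mul1r !add0r !divr1 !(addrC _ (_ - _)) !subrK.
  by case: q {Sq N N0 N1 g gam D Dn1 D1 NE Npos cN cg} => -[].
Qed.

(** Arcs join [e1] to every point except its antipode, and the antipode is reached through the
    orthogonal point [e2], which is antipodal to neither. *)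
Lemma sphere_connected (R : realType) (c : pt R) : connected (sphere c).
Proof.
pose e1 : pt R := (c.1.1 + 1, c.1.2, c.2).
have Se1 : sphere c e1 by apply/sphereE => /=; ring.
pose e2 : pt R := (c.1.1, c.1.2 + 1, c.2).
have Se2 : sphere c e2 by apply/sphereE => /=; ring.
have arc p q : sphere c p -> sphere c q ->
  (p.1.1 - c.1.1) * (q.1.1 - c.1.1) + (p.1.2 - c.1.2) * (q.1.2 - c.1.2)
    + (p.2 - c.2) * (q.2 - c.2) != -1 -> connected_component (sphere c) p q.
  by move=> Sp Sq /(sphere_arc Sp Sq)[B [cB BS Bp Bq]]; exact: (connected_component_max Bp BS).
suff -> : sphere c = connected_component (sphere c) e1 by exact: component_connected.
apply/seteqP; split; last exact: connected_component_sub.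
move=> q Sq; have [q1|q1] := eqVneq (q.1.1 - c.1.1) (-1); last first.
  apply: arc => //; apply: contra_neq q1 => /= <-; ring.
apply: (@connected_component_trans _ _ e2); apply: arc => //.
  by apply/eqP => /= ?; lra.
have /sphereE := Sq; rewrite q1 => h.
have q2 : q.1.2 - c.1.2 = 0.
  apply/eqP; rewrite -sqrf_eq0; apply/eqP.
  have := sqr_ge0 (q.1.2 - c.1.2); have := sqr_ge0 (q.2 - c.2); lra.
by apply/eqP => /= ?; lra.
Qed.

Lemma surface_in_sphere (R : realType) (M : set (pt R)) (c : pt R) :
  closed_smooth_surface M -> M `<=` sphere c -> M = sphere c.
Proof.
move=> [M0 [kM [_ chM]]] MS.
have cM : closed M by apply: compact_closed => //; exact: pt_hausdorff.
apply: (sphere_connected (c := c) M0).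
  exists (\bigcup_(V in [set V | open V /\ sphere c `&` V `<=` M]) V).
    by apply: bigcup_open => V [].
  apply/seteqP; split=> [p Mp|p [Sp [V [_ VM] Vp]]]; last by apply: VM; split.
  split; first exact: MS.
  have [k [U [f [W [Wp ch]]]]] := chM p Mp.
  by have [V [oV Vp VM]] := chart_in_sphere_open MS ch Mp Wp; exists V.
by exists M => //; rewrite setIC; apply/esym/setIidPl.
Qed.

(** * Hemispheres as smooth graph charts of the unit sphere *)

Definition disc (R : realType) : set (R * R) := [set u | u.1 ^+ 2 + u.2 ^+ 2 < 1].

Definition hemi (R : realType) (u : R * R) : R := Num.sqrt (1 - u.1 ^+ 2 - u.2 ^+ 2).

(* The algebra generated by constants, coordinates, the hemisphere function and
   its inverse is stable under both partial derivatives, which gives smoothness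
   without computing any higher derivative. *)
Inductive hemi_alg (R : realType) : (R * R -> R) -> Prop :=
| HemiCst c : hemi_alg (fun=> c)
| HemiFst : hemi_alg fst
| HemiSnd : hemi_alg snd
| HemiSqrt : hemi_alg (@hemi R)
| HemiInv : hemi_alg (fun u => (hemi u)^-1)
| HemiAdd f g : hemi_alg f -> hemi_alg g -> hemi_alg (fun u => f u + g u)
| HemiMul f g : hemi_alg f -> hemi_alg g -> hemi_alg (fun u => f u * g u).

Lemma hemi_gt0 (R : realType) (u : R * R) : disc u -> 0 < hemi u.
Proof. by rewrite /disc /= /hemi sqrtr_gt0; lra. Qed.

Lemma disc_open (R : realType) : open (@disc R).
Proof.
apply: (open_comp (f := fun u : R * R => u.1 ^+ 2 + u.2 ^+ 2) (D := [set x | x < 1])).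
  move=> u _; have c1 : (fun v : R * R => v.1) @ u --> u.1 by exact: cvg_fst.
  have c2 : (fun v : R * R => v.2) @ u --> u.2 by exact: cvg_snd.
  by apply: cvgD; [exact: (cvgM c1 c1)|exact: (cvgM c2 c2)].
exact: open_lt.
Qed.

Lemma hemi_continuous (R : realType) : continuous (@hemi R).
Proof.
move=> u; have c1 : (fun v : R * R => v.1) @ u --> u.1 by exact: cvg_fst.
have c2 : (fun v : R * R => v.2) @ u --> u.2 by exact: cvg_snd.
apply: (@continuous_comp _ _ _ (fun u : R * R => 1 - u.1 ^+ 2 - u.2 ^+ 2)).
  apply: cvgB; first by apply: cvgB; [exact: cvg_cst|exact: (cvgM c1 c1)].
  exact: (cvgM c2 c2).
exact: sqrt_continuous.
Qed.

Lemma hemi_alg_continuous (R : realType) (h : R * R -> R) u :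
  hemi_alg h -> disc u -> {for u, continuous h}.
Proof.
move=> hh Du; elim: hh => {h}.
- by move=> c; exact: cvg_cst.
- exact: cvg_fst.
- exact: cvg_snd.
- exact: hemi_continuous.
- by apply: cvgV; [rewrite gt_eqF// hemi_gt0|exact: hemi_continuous].
- by move=> f g _ cf _ cg; exact: (cvgD cf cg).
- by move=> f g _ cf _ cg; exact: (cvgM cf cg).
Qed.

(** The Boolean selects the coordinate that varies, so one argument covers both partial
    derivatives. *)
Definition coord_line (R : realType) (b : bool) (u : R * R) (t : R) : R * R :=
  if b then (t, u.2) else (u.1, t).

Definition axis_coord (R : realType) (b : bool) (u : R * R) : R := if b then u.1 else u.2.

Lemma coord_lineE (R : realType) b (u : R * R) : coord_line b u (axis_coord b u) = u.
Proof. by case: b; case: u. Qed.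

Lemma is_derive_hemi (R : realType) b (u : R * R) : disc u ->
  is_derive (axis_coord b u) 1 (fun t => hemi (coord_line b u t))
    (- axis_coord b u * (hemi u)^-1).
Proof.
move=> Du.
have [y [uy ty]] : exists y, 1 - u.1 ^+ 2 - u.2 ^+ 2 = 1 - axis_coord b u ^+ 2 - y /\
    forall t, hemi (coord_line b u t) = Num.sqrt (1 - t ^+ 2 - y).
  case: b; [exists (u.2 ^+ 2)|exists (u.1 ^+ 2)]; split=> // [|t]; rewrite /hemi/= /axis_coord; first by ring.
  by congr Num.sqrt; ring.
rewrite (_ : (fun t => _) = Num.sqrt \o (fun t => 1 - t ^+ 2 - y)); last exact/funext.
have w0 : 0 < 1 - axis_coord b u ^+ 2 - y by rewrite -uy; move: Du; rewrite /disc/=; lra.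
have dg : is_derive (axis_coord b u) 1 (fun t : R => 1 - t ^+ 2 - y) (- (2 * axis_coord b u)).
  apply: is_derive_eq; rewrite /= !scaler1; ring.
have := @is_derive1_comp _ _ (fun t => 1 - t ^+ 2 - y) _ _ _ (is_derive1_sqrt w0) dg.
move=> /is_derive_eq; apply; rewrite /hemi uy invfM.
set q := (Num.sqrt _)^-1.
by field.
Qed.

Lemma hemi_alg_derive (R : realType) b (h : R * R -> R) : hemi_alg h ->
  exists2 h', hemi_alg h' & forall u, disc u ->
    is_derive (axis_coord b u) 1 (fun t => h (coord_line b u t)) (h' u).
Proof.
elim=> {h}.
- move=> c; exists (fun=> 0); first exact: HemiCst.
  by move=> u _; exact: is_derive_cst.
- exists (fun=> b%:R); first exact: HemiCst.
  by case: b => u _; [exact: is_derive_id|exact: is_derive_cst].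
- exists (fun=> (~~ b)%:R); first exact: HemiCst.
  by case: b => u _; [exact: is_derive_cst|exact: is_derive_id].
- exists (fun u => (-1 * axis_coord b u) * (hemi u)^-1).
    apply: HemiMul; last exact: HemiInv.
    apply: HemiMul; first exact: HemiCst.
    by case: b; [exact: HemiFst|exact: HemiSnd].
  by move=> u Du; rewrite mulN1r; exact: is_derive_hemi.
- exists (fun u => axis_coord b u * ((hemi u)^-1 * ((hemi u)^-1 * (hemi u)^-1))).
    apply: HemiMul; first by case: b; [exact: HemiFst|exact: HemiSnd].
    by apply: HemiMul; [|apply: HemiMul]; exact: HemiInv.
  move=> u Du; have d := is_derive_hemi b Du.
  have nz : hemi (coord_line b u (axis_coord b u)) != 0.
    by rewrite coord_lineE gt_eqF// hemi_gt0.
  have := @is_deriveV _ (fun t => hemi (coord_line b u t)) _ _ _ nz d; move=> /is_derive_eq; apply.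
  rewrite coord_lineE -exprVn /=.
  rewrite /GRing.scale /=; ring.
- move=> f g _ [f' hf df] _ [g' hg dg]; exists (fun u => f' u + g' u).
    exact: HemiAdd.
  move=> u Du; exact: (is_deriveD (df u Du) (dg u Du)).
- move=> f g hf [f' hf' df] hg [g' hg' dg].
  exists (fun u => f u * g' u + g u * f' u).
    by apply: HemiAdd; exact: HemiMul.
  move=> u Du; have := is_deriveM (df u Du) (dg u Du).
  by rewrite !coord_lineE.
Qed.

(** Agreement is required on the disc only, because that is where the partial derivatives of [f] are
    known to equal members of the algebra. The disc is open, so agreement passes to derivatives and
    the induction on [n] closes. *)
Lemma hemi_alg_Cn (R : realType) n (f h : R * R -> R) :
  hemi_alg h -> (forall u, disc u -> f u = h u) -> Cn_on n (@disc R) f.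
Proof.
elim: n f h => [|n IH] f h hh fh.
  move=> u Du; have ch := hemi_alg_continuous hh Du.
  rewrite /prop_for /continuous_at fh//; apply: cvg_trans ch.
  apply: near_eq_cvg; have := open_nbhs_nbhs (conj (@disc_open R) Du).
  by apply: filterS => v Dv; rewrite fh.
have line_eq b u : disc u ->
    \forall t \near axis_coord b u, h (coord_line b u t) = f (coord_line b u t).
  move=> Du.
  have cl : coord_line b u t @[t --> axis_coord b u] --> u.
    have ci (x : R) : t @[t --> x] --> x by exact: cvg_id.
    have cc (x y : R) : (fun=> y) t @[t --> x] --> y by exact: cvg_cst.
    by move: u Du => [x y] Du; case: (b);
      [exact: (cvg_pair_nbhs (ci x) (cc x y))|exact: (cvg_pair_nbhs (cc y x) (ci y))].
  have nD : \forall t \near axis_coord b u, disc (coord_line b u t).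
    exact: (cl _ (open_nbhs_nbhs (conj (@disc_open R) Du))).
  by apply: filterS nD => t Dt; rewrite fh.
have der b u h' : disc u ->
    is_derive (axis_coord b u) 1 (fun t => h (coord_line b u t)) h' ->
    is_derive (axis_coord b u) 1 (fun t => f (coord_line b u t)) h'.
  by move=> Du; apply: near_eq_is_derive; exact: line_eq.
have [h1 hh1 d1] := hemi_alg_derive true hh.
have [h2 hh2 d2] := hemi_alg_derive false hh.
split; [|split; [exact: IH hh fh|split]].
- move=> u Du; split.
    by have [] := der true u _ Du (d1 u Du).
  by have [] := der false u _ Du (d2 u Du).
- apply: (IH _ h1) => // u Du; rewrite /pd1 derive1E.
  by have [] := der true u _ Du (d1 u Du).
- apply: (IH _ h2) => // u Du; rewrite /pd2 derive1E.
  by have [] := der false u _ Du (d2 u Du).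
Qed.

Lemma hemi_smooth (R : realType) (s : R) : smooth_on (@disc R) (fun u => s * hemi u).
Proof.
move=> n; apply: (@hemi_alg_Cn _ n _ (fun u => s * hemi u)) => //.
by apply: HemiMul; [exact: HemiCst|exact: HemiSqrt].
Qed.

(** The sign [s] selects one of the two hemispheres along axis [k]. There [s] times the height is
    the positive root of 1 minus the squared norm of the projection, which is [hemi]. *)
Lemma hemisphere_chart (R : realType) (k : 'I_3) (s : R) : s ^+ 2 = 1 ->
  is_chart (@sphere2 R) k (@disc R) (fun u => s * hemi u)
    [set p | 0 < s * chart_height k p].
Proof.
move=> s2; split; first exact: disc_open.
split; first exact: hemi_smooth.
split.
  apply: (open_comp (f := fun q : pt R => s * chart_height k q) (D := [set x | 0 < x])).
    by move=> q _; apply: cvgM; [exact: cvg_cst|exact: chart_height_continuous].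
  exact: open_gt.
have [h0 [p1 p2]] : chart_height k (@origin R) = 0 /\
    (chart_proj k (@origin R)).1 = 0 /\ (chart_proj k (@origin R)).2 = 0.
  by case: k => -[|[|[|]]].
have sphE (p : pt R) : sphere2 p <-> (chart_height k p) ^+ 2 + (chart_proj k p).1 ^+ 2
    + (chart_proj k p).2 ^+ 2 = 1.
  by have := sphere_chartE k (@origin R) p; rewrite h0 p1 p2 !subr0.
apply/seteqP; split=> [p [/sphE Sp /= sp]|_ [u Du <-]].
  have hs : hemi (chart_proj k p) = s * chart_height k p.
    rewrite /hemi -Sp -[RHS]ger0_norm ?ltW// -sqrtr_sqr exprMn s2; congr Num.sqrt; ring.
  exists (chart_proj k p).
    rewrite /disc /=; have : 0 < chart_height k p ^+ 2.
      by rewrite -(mul1r (_ ^+ 2)) -s2 -exprMn exprn_gt0.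
    lra.
  by apply: chart_coordK; rewrite hs mulrA -expr2 s2 mul1r.
have w0 := hemi_gt0 Du.
split=> /=; last by rewrite chart_heightE mulrA -expr2 s2 mul1r.
apply/sphE; rewrite chart_heightE graphK exprMn s2 mul1r sqr_sqrtr; first by ring.
by move: Du; rewrite /disc/=; lra.
Qed.

(** * From the distance distribution to the moments of the distance *)

Lemma real_measure_unique (R : realType) (m1 m2 : {measure set R -> \bar R}) :
  (m1 setT < +oo)%E -> (m2 setT < +oo)%E -> m1 setT = m2 setT ->
  (forall r : R, m1 `]-oo, r]%classic = m2 `]-oo, r]%classic) ->
  forall A : set R, measurable A -> m1 A = m2 A.
Proof.
move=> f1 f2 eqT eqr.
have itvE (m : {measure set R -> \bar R}) x : (m setT < +oo)%E ->
    m `]x, +oo[%classic = (m setT - m `]-oo, x]%classic)%E.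
  by move=> fm; rewrite -setCitvl -setTD measureD ?setTI.
(* The rays []x, +oo[] are stable under intersection and generate the Borel sets, and those starting
   at [- k] exhaust the line. Finite total mass gives their measure by complement. *)
refine (@measure_unique _ _ _ (@RGenOInfty.G R) (fun k : nat => `](- k%:R), +oo[%classic)
   (RGenOInfty.measurableE R) _ _ _ m1 m2 _ _).
- move=> _ _ [x ->] [y ->]; exists (Num.max x y).
  by apply/seteqP; split=> z /=; rewrite !in_itv/= !andbT gt_max => /andP.
- by move=> k; exists (- k%:R).
- apply/seteqP; split=> // x _; exists (Num.truncn `|x|).+1 => //=.
  rewrite in_itv/= andbT ltrNl; apply: le_lt_trans (ler_norm _) _.
  by rewrite normrN truncnS_gt.
- by move=> _ [x ->]; rewrite !itvE// eqT eqr.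
- by move=> k; apply: le_lt_trans f1; apply: le_measure; rewrite ?inE.
Qed.

Lemma measurable_dist3 (R : realType) :
  measurable_fun setT (fun xx : pt R * pt R => dist3 xx.1 xx.2).
Proof.
apply: (measurableT_comp (continuous_measurable_fun (@sqrt_continuous R))).
have mc (p : pt R -> R) : continuous p ->
    measurable_fun setT (fun xx : pt R * pt R => (p xx.1 - p xx.2) ^+ 2).
  move=> /continuous_pt_measurable mp; apply: measurable_funX.
  by apply: measurable_funB; apply: measurableT_comp.
apply: measurable_funD; first apply: measurable_funD.
- by apply: (mc (fun p => p.1.1)); exact: (@chart_height_continuous R ord0).
- by apply: (mc (fun p => p.1.2)); exact: (@chart_height_continuous R (@Ordinal 3 1 isT)).
- by apply: (mc snd) => p; exact: cvg_snd.
Qed.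

(** The global distance distribution is the cumulative distribution function of the law of the
    distance, the pushforward [nu] of the product measure. It determines this law, and the moments
    are integrals against it. *)
Lemma dist_moment_eq (R : realType) (P Q : probability (pt R) R) :
  (forall r : R, 0 <= r -> global_dist_distr P r = global_dist_distr Q r) ->
  forall n : nat,
  (\int[P \x P]_z (dist3 z.1 z.2 ^+ n)%:E = \int[Q \x Q]_z (dist3 z.1 z.2 ^+ n)%:E)%E.
Proof.
move=> eqH n.
pose d := fun xx : pt R * pt R => dist3 xx.1 xx.2.
have md : measurable_fun setT d := @measurable_dist3 R.
have PT (P' : probability (pt R) R) : (P' \x P')%E setT = 1%E.
  rewrite -setXTT product_measure1E// -[RHS]mule1.
  by congr (_ * _)%E; exact: probability_setT.
have d0 z : 0 <= d z by exact: sqrtr_ge0.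
pose nu (P' : probability (pt R) R) : {measure set R -> \bar R} :=
  measure_function_pushforward__canonical__measure_function_Measure (P' \x P')%E md.
have nuE P' A : nu P' A = (P' \x P')%E (d @^-1` A) by [].
have eqnu : forall A : set R, measurable A -> nu P A = nu Q A.
  apply: real_measure_unique; rewrite ?nuE ?preimage_setT ?PT ?ltry//.
  move=> r; rewrite !nuE; have -> : d @^-1` `]-oo, r]%classic = [set xx | dist3 xx.1 xx.2 <= r].
    by apply/seteqP; split=> z /=; rewrite in_itv.
  (* For negative [r] both sublevel sets are empty, so the hypothesis on nonnegative radii
     suffices. *)
  have [r0|r0] := leP 0 r; first exact: eqH.
  rewrite (_ : [set _ | _] = set0) ?measure0//; apply/seteqP; split => // z /= dr.
  by have := le_lt_trans (le_trans (d0 z) dr) r0; rewrite ltxx.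
(* Restricting to [[0, +oo[], where distances lie, keeps the integrand nonnegative for odd [n] as
   well. *)
have mp (P' : probability (pt R) R) : (\int[P' \x P']_z (dist3 z.1 z.2 ^+ n)%:E =
    \int[nu P']_(r in `[0%R, +oo[) (r ^+ n)%:E)%E.
  rewrite (ge0_integral_pushforward md)//=.
  - rewrite (_ : _ @^-1` _ = setT)//; apply/seteqP; split=> // z _.
    by rewrite /= in_itv/= d0.
  - by apply/measurable_EFinP; apply: measurable_funX.
  - by move=> r; rewrite inE/= in_itv/= andbT => r0; rewrite lee_fin exprn_ge0.
rewrite !mp; apply: eq_measure_integral => A mA _; exact: eqnu.
Qed.

(** * Averages of continuous functions over a compact carrier *)

Section average.
Context (R : realType) (M : set (pt R)) (P : probability (pt R) R).
Hypothesis kM : compact M.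
Hypothesis PM : P (~` M) = 0%E.

(** Integrating over [M] instead of the whole space makes every continuous function integrable,
    since it is bounded on a compact set; as [P] is carried by [M], the value is the expectation. *)
Definition avg (g : pt R -> R) : R := (\int[P]_(x in M) g x)%R.

Let cM : closed M. Proof. by apply: compact_closed => //; exact: pt_hausdorff. Qed.

Let mM : measurable M. Proof. exact: closed_pt_measurable. Qed.

Lemma continuous_integrable (g : pt R -> R) :
  continuous g -> P.-integrable M (EFin \o g).
Proof.
move=> cg; apply: measurable_bounded_integrable => //.
- by apply: le_lt_trans (ltry 1); exact: probability_le1.
- by apply: measurable_funTS; exact: continuous_pt_measurable.
- have : compact (g @` M) by apply: continuous_compact => //; exact: continuous_subspaceT.
  move/compact_bounded => [B [Br hB]]; exists B; split=> // x xB y My.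
  by apply: (hB x xB); exists y.
Qed.

Lemma avgD (f g : pt R -> R) : continuous f -> continuous g ->
  avg (fun p => f p + g p) = avg f + avg g.
Proof. by move=> cf cg; apply: RintegralD => //; exact: continuous_integrable. Qed.

Lemma avgZ (c : R) (g : pt R -> R) : continuous g ->
  avg (fun p => c * g p) = c * avg g.
Proof. by move=> cg; apply: RintegralZl => //; exact: continuous_integrable. Qed.

Lemma probability_carrier : P M = 1%E.
Proof.
have := probability_setC P mM; rewrite PM => /esym.
have := probability_le1 P mM; have := measure_ge0 P M.
by case: (P M) => //= r _ _ /eqP; rewrite -EFinB eqe subr_eq0 => /eqP <-.
Qed.

Lemma avg_cst (c : R) : avg (fun=> c) = c.
Proof. by rewrite /avg Rintegral_cst// [X in fine X]probability_carrier mulr1. Qed.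

Lemma integral_avg (g : pt R -> R) : continuous g -> (forall p, 0 <= g p) ->
  (\int[P]_x (g x)%:E = (avg g)%:E)%E.
Proof.
move=> cg g0; rewrite /avg /Rintegral fineK; last first.
  by apply: integrable_fin_num => //; exact: continuous_integrable.
rewrite (ge0_negligible_integral (N := ~` M))//.
- by rewrite setTD setCK.
- exact: measurableC.
- by apply/measurable_EFinP; exact: continuous_pt_measurable.
- by move=> x _; rewrite lee_fin.
Qed.

Lemma integral2_avg (G : pt R -> pt R -> R) :
  measurable_fun setT (fun z : pt R * pt R => G z.1 z.2) ->
  (forall x y, 0 <= G x y) -> (forall x, continuous (G x)) ->
  continuous (fun x => avg (G x)) ->
  (\int[P \x P]_z (G z.1 z.2)%:E = (avg (fun x => avg (G x)))%:E)%E.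
Proof.
move=> mG G0 cG caG; rewrite fubini_tonelli1/=; last 2 first.
- exact/measurable_EFinP.
- by move=> z; rewrite lee_fin.
rewrite /fubini_F /= -integral_avg//; last first.
  by move=> x; apply: Rintegral_ge0 => y _; exact: G0.
by apply: eq_integral => x _; rewrite -integral_avg.
Qed.

(** By continuity [g] exceeds half its value at [p] on an open neighborhood of [p], which has
    positive mass. *)
Lemma avg_gt0 (g : pt R -> R) p : continuous g -> (forall q, 0 <= g q) ->
  (forall V, open V -> V p -> (0 < P V)%E) -> 0 < g p -> 0 < avg g.
Proof.
move=> cg g0 supp gp.
pose V := [set q | g p / 2 < g q].
have oV : open V by apply: (open_comp (f := g) (D := [set x | g p / 2 < x])) => //; exact: open_gt.
have Vp : V p by rewrite /V /=; lra.
have mV := open_pt_measurable oV.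
rewrite -lte_fin -integral_avg//.
apply: (@lt_le_trans _ _ (\int[P]_(x in V) (g p / 2)%:E)%E).
  by rewrite integral_cst// mule_gt0 ?supp// lte_fin; lra.
apply: (@le_trans _ _ (\int[P]_(x in V) (g x)%:E)%E).
  apply: ge0_le_integral => //.
  - by move=> x _; rewrite lee_fin; lra.
  - apply/measurable_EFinP; apply: measurable_funTS; exact: continuous_pt_measurable.
  - by move=> x; rewrite /V /= lee_fin => /ltW.
apply: ge0_subset_integral => //.
- by apply/measurable_EFinP; exact: continuous_pt_measurable.
- by move=> x _; rewrite lee_fin.
Qed.

End average.

(** * Second and fourth moments of the distance about the mean *)

Definition dx (R : realType) (m p : pt R) : R := p.1.1 - m.1.1.
Definition dy (R : realType) (m p : pt R) : R := p.1.2 - m.1.2.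
Definition dz (R : realType) (m p : pt R) : R := p.2 - m.2.
Definition sqdist (R : realType) (m p : pt R) : R :=
  dx m p * dx m p + dy m p * dy m p + dz m p * dz m p.

Section moments.
Context (R : realType) (M : set (pt R)) (P : probability (pt R) R).
Hypothesis kM : compact M.
Hypothesis PM : P (~` M) = 0%E.

(** A syntactic list of coefficients and functions: a polynomial in the coordinates is matched with
    it by one [ring] identity and then averaged term by term. *)
Definition lincomb (l : seq (R * (pt R -> R))) (p : pt R) : R :=
  foldr (fun cg acc => cg.1 * cg.2 p + acc) 0 l.

Fixpoint all_continuous (l : seq (R * (pt R -> R))) : Prop :=
  if l is cg :: l' then continuous cg.2 /\ all_continuous l' else True.

Lemma continuous_pt_add (f g : pt R -> R) :
  continuous f -> continuous g -> continuous (fun p => f p + g p).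
Proof. by move=> cf cg p; exact: (cvgD (cf p) (cg p)). Qed.

Lemma continuous_pt_mul (f g : pt R -> R) :
  continuous f -> continuous g -> continuous (fun p => f p * g p).
Proof. by move=> cf cg p; exact: (cvgM (cf p) (cg p)). Qed.

Lemma continuous_pt_cst (c : R) : continuous (fun _ : pt R => c).
Proof. by move=> p; exact: cvg_cst. Qed.

Lemma avg_lincomb l : all_continuous l ->
  continuous (lincomb l) /\
  avg M P (lincomb l) = foldr (fun cg acc => cg.1 * avg M P cg.2 + acc) 0 l.
Proof.
elim: l => [_|[c g] l IH [/= cg /IH[cl al]]].
  by split; [exact: continuous_pt_cst|exact: avg_cst].
have cc : continuous (fun p => c * g p) by apply: continuous_pt_mul => //; exact: continuous_pt_cst.
split; first exact: continuous_pt_add.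
by rewrite -al avgD// avgZ.
Qed.

Context (m : pt R).
Local Notation X := (dx m).
Local Notation Y := (dy m).
Local Notation Z := (dz m).
Local Notation A := (sqdist m).
Local Notation E := (avg M P).

Lemma dx_continuous : continuous X.
Proof.
by apply: continuous_pt_add; [exact: (@chart_height_continuous R ord0)|exact: continuous_pt_cst].
Qed.
Lemma dy_continuous : continuous Y.
Proof.
by apply: continuous_pt_add; [exact: (@chart_height_continuous R (@Ordinal 3 1 isT))|exact: continuous_pt_cst].
Qed.
Lemma dz_continuous : continuous Z.
Proof.
by apply: continuous_pt_add; [exact: (@chart_height_continuous R (@Ordinal 3 2 isT))|exact: continuous_pt_cst].
Qed.
Lemma sqdist_continuous : continuous A.
Proof.
by do 2?apply: continuous_pt_add; apply: continuous_pt_mul;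
  (exact: dx_continuous || exact: dy_continuous || exact: dz_continuous).
Qed.

Let cX := dx_continuous.
Let cY := dy_continuous.
Let cZ := dz_continuous.
Let cA := sqdist_continuous.

Hypothesis EX : E X = 0.
Hypothesis EY : E Y = 0.
Hypothesis EZ : E Z = 0.

Local Notation s := (E A).

Let dist2E x y : dist3 x y ^+ 2 = A x + A y - 2 * (X x * X y + Y x * Y y + Z x * Z y).
Proof.
rewrite /dist3 sqr_sqrtr; last by rewrite !addr_ge0// sqr_ge0.
by rewrite /sqdist /dx /dy /dz; ring.
Qed.

Lemma dist2_moment :
  (\int[P \x P]_z (dist3 z.1 z.2 ^+ 2)%:E = (2 * s)%:E)%E.
Proof.
(* The squared distance as a function of the second point, with coefficients depending on [x].
   Averaging kills the last three terms, because [m] is the mean. *)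
pose l x : seq (R * (pt R -> R)) :=
  [:: (A x, fun=> 1); (1, A); (- 2 * X x, X); (- 2 * Y x, Y); (- 2 * Z x, Z)].
have dl x : (fun y => dist3 x y ^+ 2) = lincomb (l x).
  by apply/funext => y; rewrite dist2E /lincomb /=; ring.
have cl x : all_continuous (l x) by do !split => //; exact: continuous_pt_cst.
have al x : avg M P (fun y => dist3 x y ^+ 2) = lincomb [:: (1, A); (s, fun=> 1)] x.
  rewrite dl (avg_lincomb (cl x)).2 /= (avg_cst kM PM).
  by rewrite EX EY EZ /lincomb /=; ring.
have c1 : all_continuous [:: (1, A); (s, fun=> 1)] by do !split => //; exact: continuous_pt_cst.
rewrite (integral2_avg kM PM (G := fun x y => dist3 x y ^+ 2)).
- congr EFin; under [X in avg M P X]eq_fun do rewrite al.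
  by rewrite (avg_lincomb c1).2 /= (avg_cst kM PM); ring.
- by apply: measurable_funX; exact: measurable_dist3.
- by move=> x y; rewrite sqr_ge0.
- by move=> x; rewrite dl; exact: (avg_lincomb (cl x)).1.
- by under eq_fun do rewrite al; exact: (avg_lincomb c1).1.
Qed.

Local Notation XX := (fun p : pt R => X p * X p).
Local Notation YY := (fun p : pt R => Y p * Y p).
Local Notation ZZ := (fun p : pt R => Z p * Z p).
Local Notation XY := (fun p : pt R => X p * Y p).
Local Notation XZ := (fun p : pt R => X p * Z p).
Local Notation YZ := (fun p : pt R => Y p * Z p).
Local Notation AA := (fun p : pt R => A p * A p).

Lemma dist4_moment :
  (\int[P \x P]_z (dist3 z.1 z.2 ^+ 4)%:E =
    (2 * E AA + 2 * s ^+ 2 + 4 * (E XX ^+ 2 + E YY ^+ 2 + E ZZ ^+ 2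
      + 2 * (E XY ^+ 2 + E XZ ^+ 2 + E YZ ^+ 2)))%:E)%E.
Proof.
pose AX p := A p * X p; pose AY p := A p * Y p; pose AZ p := A p * Z p.
have cXX : continuous XX by exact: continuous_pt_mul.
have cYY : continuous YY by exact: continuous_pt_mul.
have cZZ : continuous ZZ by exact: continuous_pt_mul.
have cAA : continuous AA by exact: continuous_pt_mul.
have cXY : continuous XY by exact: continuous_pt_mul.
have cXZ : continuous XZ by exact: continuous_pt_mul.
have cYZ : continuous YZ by exact: continuous_pt_mul.
have cAX : continuous AX by exact: continuous_pt_mul.
have cAY : continuous AY by exact: continuous_pt_mul.
have cAZ : continuous AZ by exact: continuous_pt_mul.
(* The square of A x + A y - 2 <x, y>, sorted by functions of the second point. The coefficients 4
   and 8 come from 4 <x, y>^2, and the last six terms from - 4 (A x + A y) <x, y>. *)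
pose l x : seq (R * (pt R -> R)) :=
  [:: (AA x, fun=> 1); (1, AA); (2 * A x, A);
      (4 * XX x, XX); (4 * YY x, YY); (4 * ZZ x, ZZ);
      (8 * XY x, XY); (8 * XZ x, XZ); (8 * YZ x, YZ);
      (- 4 * AX x, X); (- 4 * AY x, Y); (- 4 * AZ x, Z);
      (- 4 * X x, AX); (- 4 * Y x, AY); (- 4 * Z x, AZ)].
have dl x : (fun y => dist3 x y ^+ 4) = lincomb (l x).
  apply/funext => y; rewrite (exprM _ 2 2) dist2E /lincomb /=.
  by rewrite /AX /AY /AZ /sqdist; ring.
have cl x : all_continuous (l x) by do !split => //; exact: continuous_pt_cst.
(* The average over the second point, as a function of the first. The terms linear in the second
   point have vanished; those linear in the first remain and vanish in the second averaging. *)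
pose l' : seq (R * (pt R -> R)) :=
  [:: (1, AA); (E AA, fun=> 1); (2 * s, A); (4 * E XX, XX); (4 * E YY, YY); (4 * E ZZ, ZZ);
      (8 * E XY, XY); (8 * E XZ, XZ); (8 * E YZ, YZ);
      (- 4 * E AX, X); (- 4 * E AY, Y); (- 4 * E AZ, Z)].
have al x : avg M P (fun y => dist3 x y ^+ 4) = lincomb l' x.
  rewrite dl (avg_lincomb (cl x)).2 /= (avg_cst kM PM).
  by rewrite EX EY EZ /lincomb /=; ring.
have c1 : all_continuous l' by do !split => //; exact: continuous_pt_cst.
rewrite (integral2_avg kM PM (G := fun x y => dist3 x y ^+ 4)).
- congr EFin; under [X in avg M P X]eq_fun do rewrite al.
  rewrite (avg_lincomb c1).2 /= (avg_cst kM PM) EX EY EZ; ring.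
- by apply: measurable_funX; exact: measurable_dist3.
- by move=> x y; rewrite exprn_even_ge0.
- by move=> x; rewrite dl; exact: (avg_lincomb (cl x)).1.
- by under eq_fun do rewrite al; exact: (avg_lincomb c1).1.
Qed.

End moments.

(** * Normalization, and the symmetries and moments of the unit sphere *)

Lemma normalized_probability (R : realType) (mu : {measure set pt R -> \bar R}) :
  (0 < mu setT)%E -> (mu setT < +oo)%E ->
  exists P : probability (pt R) R, normalized mu = P.
Proof.
(* The Dirac mass is the default value of [mnormalize] for zero or infinite total mass; both cases
   are excluded here, so its choice is immaterial. *)
move=> mu0 muoo; exists (mnormalize mu (dirac (@origin R))).
by apply/funext => A; rewrite /normalized /= /mnormalize gt_eqF//= lt_eqF.
Qed.

(** The integrals over [D] and over its preimage under [T] cancel, and [g] vanishes on the rest of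
    [M]. Invariance of [P] is asked only for subsets of [D], so that it can be checked in hemisphere
    charts. *)
Lemma avg_odd (R : realType) (M D : set (pt R)) (P : probability (pt R) R)
    (T : pt R -> pt R) (g : pt R -> R) :
  compact M -> continuous g -> measurable_fun setT T -> (forall p, g (T p) = - g p) ->
  measurable D -> D `<=` M -> T @^-1` D `<=` M -> (forall p, D p -> ~ D (T p)) ->
  (forall p, M p -> ~ D p -> ~ D (T p) -> g p = 0) ->
  (forall A, measurable A -> A `<=` D -> P (T @^-1` A) = P A) ->
  avg M P g = 0.
Proof.
move=> kM cg mT gT mD DM D'M DD' g0 PT.
have mM : measurable M.
  by apply: closed_pt_measurable; apply: compact_closed => //; exact: pt_hausdorff.
have mD' : measurable (T @^-1` D) by rewrite -[X in measurable X]setTI; exact: mT.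
have ig := continuous_integrable P kM cg.
have mU : measurable (D `|` T @^-1` D) by exact: measurableU.
have UM : D `|` T @^-1` D `<=` M by move=> p [/DM|/D'M].
have -> : avg M P g = \int[P]_(x in D) g x + \int[P]_(x in T @^-1` D) g x.
  have ME : M = (D `|` T @^-1` D) `|` (M `\` (D `|` T @^-1` D)) by rewrite setDUK.
  have mr : measurable (M `\` (D `|` T @^-1` D)) by exact: measurableD.
  rewrite /avg {1}ME Rintegral_setU -?ME//; last by apply/disj_setPS => p [Up []].
  rewrite (Rintegral_setU mD mD' (integrableS mM mU UM ig)); last first.
    by apply/disj_setPS => p [Dp]; exact: DD'.
  rewrite [X in _ + X](_ : _ = 0) ?addr0//.
  rewrite (_ : 0 = \int[P]_(x in M `\` (D `|` T @^-1` D)) 0); last first.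
    by rewrite Rintegral_cst// mul0r.
  apply: eq_Rintegral => p; rewrite inE => -[Mp nD].
  by apply: g0 => // Dp; apply: nD; [left|right].
(* The pushforward of [P] under [T] agrees with [P] on subsets of [D]; the change of variables then
   replaces [g] by its composite with [T], which is [- g]. *)
have ->: \int[P]_(x in D) g x = \int[P]_(x in T @^-1` D) (- g x).
  rewrite /Rintegral; congr fine.
  pose nu : {measure set pt R -> \bar R} :=
    measure_function_pushforward__canonical__measure_function_Measure P mT.
  transitivity (\int[nu]_(x in D) (g x)%:E)%E.
    by apply: eq_measure_integral => A mA AD; exact: (esym (PT A mA AD)).
  rewrite (integral_pushforward mT)//.
  - by apply: eq_integral => p _ /=; rewrite gT.
  - by apply/measurable_EFinP; exact: continuous_pt_measurable.
  - rewrite (_ : _ \o T = fun x => (- g x)%:E); last by apply/funext => p /=; rewrite gT.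
    have cNg : continuous (fun p => - g p) by move=> p; exact: (cvgN (cg p)).
    exact: (integrableS mM mD' D'M (continuous_integrable P kM cNg)).
have -> : \int[P]_(x in T @^-1` D) (- g x) = - \int[P]_(x in T @^-1` D) g x.
  rewrite -[RHS]mulN1r -RintegralZl//; last exact: (integrableS mM).
  by apply: eq_Rintegral => p _; rewrite mulN1r.
by rewrite addNr.
Qed.

Lemma sphere2_closed (R : realType) : closed (@sphere2 R).
Proof.
have cc (k : 'I_3) : continuous (fun p : pt R => chart_height k p * chart_height k p).
  by apply: continuous_pt_mul; exact: chart_height_continuous.
pose n (p : pt R) := p.1.1 * p.1.1 + p.1.2 * p.1.2 + p.2 * p.2.
have cn : continuous n.
  apply: continuous_pt_add; first apply: continuous_pt_add.
  - exact: (cc ord0).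
  - exact: (cc (@Ordinal 3 1 isT)).
  - exact: (cc (@Ordinal 3 2 isT)).
have -> : @sphere2 R = n @^-1` [set 1].
  apply/seteqP; split=> p.
    by move=> /(sphereE (@origin R)); rewrite /= !subr0.
  by move=> np; apply/(sphereE (@origin R)); rewrite /= !subr0.
by apply: closed_comp => [? _|]; [exact: cn|exact: closed_eq].
Qed.

Lemma sphere2_compact (R : realType) : compact (@sphere2 R).
Proof.
have kI : compact `[(-1 : R), 1]%classic by exact: segment_compact.
apply: (subclosed_compact (@sphere2_closed R) (compact_setX (compact_setX kI kI) kI)).
move=> p /(sphereE (@origin R)); rewrite /= !subr0 => Sp.
have h (x y z : R) : x ^+ 2 + y ^+ 2 + z ^+ 2 = 1 -> x \in `[-1, 1].
  move=> xyz; rewrite in_itv /= -ler_norml -(@expr_le1 _ 2)// real_normK ?num_real//.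
  by have := sqr_ge0 y; have := sqr_ge0 z; lra.
split; first split.
- exact: h Sp.
- by apply: (h _ p.1.1 p.2); rewrite -Sp; ring.
- by apply: (h _ p.1.1 p.1.2); rewrite -Sp; ring.
Qed.

Lemma sphere2_charts (R : realType) (p : pt R) : sphere2 p ->
  exists k U f W, W p /\ is_chart (@sphere2 R) k U f W.
Proof.
move=> Sp; have [k hk] : exists k, chart_height k p != 0.
  apply: contrapT => nk.
  have h k : chart_height k p = 0 by apply/eqP; apply: contrapT => /negP hk; apply: nk; exists k.
  move: Sp => /(sphereE (@origin R)); rewrite /= !subr0.
  rewrite [p.1.1](h ord0) [p.1.2](h (@Ordinal 3 1 isT)) [p.2](h (@Ordinal 3 2 isT)).
  by rewrite !expr0n /= !addr0 => /esym/eqP; rewrite oner_eq0.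
pose s := Num.sg (chart_height k p).
exists k, (@disc R), (fun u => s * hemi u), [set q | 0 < s * chart_height k q]; split.
  by rewrite /= /s -normrEsg normr_gt0.
by apply: hemisphere_chart; rewrite /s sqr_sg hk.
Qed.

Lemma area_density_hemi (R : realType) (s : R) (u : R * R) : s ^+ 2 = 1 -> disc u ->
  area_density (fun v => s * hemi v) u =
  Num.sqrt (1 + (u.1 / hemi u) ^+ 2 + (u.2 / hemi u) ^+ 2).
Proof.
move=> s2 Du.
have d b : derive1 (fun t => s * hemi (coord_line b u t)) (axis_coord b u) =
    s * (- axis_coord b u * (hemi u)^-1).
  by rewrite derive1E; have [_ ->] := is_deriveZ s (is_derive_hemi b Du).
rewrite /area_density (_ : pd1 _ _ = s * (- u.1 * (hemi u)^-1)); last exact: (d true).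
rewrite (_ : pd2 _ _ = s * (- u.2 * (hemi u)^-1)); last exact: (d false).
by rewrite !(@exprMn _ _ s) s2 !mul1r !mulNr !sqrrN.
Qed.

(** [T] sends one hemisphere chart to the other without changing the parameter, and the area density
    of a hemisphere depends neither on its axis nor on its sign. Both masses are therefore the same
    integral over the disc. *)
Lemma sphere_mass_transport (R : realType) (mu : {measure set pt R -> \bar R})
    (k k' : 'I_3) (s s' : R) (T : pt R -> pt R) (A : set (pt R)) :
  surface_measure (@sphere2 R) mu -> s ^+ 2 = 1 -> s' ^+ 2 = 1 ->
  measurable_fun setT T ->
  (forall p, chart_proj k' (T p) = chart_proj k p) ->
  (forall p, s' * chart_height k' (T p) = s * chart_height k p) ->
  measurable A -> A `<=` @sphere2 R `&` [set p | 0 < s' * chart_height k' p] ->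
  mu (T @^-1` A) = mu A.
Proof.
move=> smu s2 s2' mT Tproj Tht mA AS.
have Tsq p : chart_height k' (T p) ^+ 2 = chart_height k p ^+ 2.
  by rewrite -[LHS]mul1r -s2' -exprMn Tht exprMn s2 mul1r.
have Tgr u : T (graph k (fun v => s * hemi v) u) = graph k' (fun v => s' * hemi v) u.
  set q := T _; have qu : chart_proj k' q = u by rewrite Tproj graphK.
  rewrite -[in RHS]qu chart_coordK// qu.
  have := Tht (graph k (fun v => s * hemi v) u); rewrite -/q chart_heightE mulrA -expr2 s2 mul1r.
  by move=> <-; rewrite mulrA -expr2 s2' mul1r.
have STS p : sphere2 (T p) -> sphere2 p.
  move=> /(sphere_chartE k' (@origin R)) h; apply/(sphere_chartE k (@origin R)).
  rewrite -h Tproj.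
  have o0 j : chart_height j (@origin R) = 0 by case: j => -[|[|[|]]].
  have o1 j : (chart_proj j (@origin R)).1 = 0 by case: j => -[|[|[|]]].
  have o2 j : (chart_proj j (@origin R)).2 = 0 by case: j => -[|[|[|]]].
  by rewrite !o0 !o1 !o2 !subr0 Tsq.
have mTA : measurable (T @^-1` A) by rewrite -[X in measurable X]setTI; exact: mT.
rewrite (smu.2 _ _ _ _ (hemisphere_chart k' s2') _ mA AS).
rewrite (smu.2 _ _ _ _ (hemisphere_chart k s2) _ mTA); last first.
  by move=> p /AS[/STS Sp /=]; rewrite Tht => hp; split.
have -> : @disc R `&` graph k (fun u => s * hemi u) @^-1` (T @^-1` A) =
    @disc R `&` graph k' (fun u => s' * hemi u) @^-1` A.
  by apply/seteqP; split=> u [Du]; rewrite /preimage /= Tgr.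
apply: eq_integral => u; rewrite inE => -[Du _].
by rewrite !area_density_hemi.
Qed.

Lemma measurable_pt_fun (R : realType) (f g h : pt R -> R) :
  continuous f -> continuous g -> continuous h ->
  measurable_fun setT (fun p : pt R => (f p, g p, h p)).
Proof.
by move=> cf cg ch; apply: measurable_fun_pair; [apply: measurable_fun_pair|];
  exact: continuous_pt_measurable.
Qed.

Definition flip_coord (R : realType) (k : 'I_3) (p : pt R) : pt R :=
  if val k == 0%N then (- p.1.1, p.1.2, p.2)
  else if val k == 1%N then (p.1.1, - p.1.2, p.2)
  else (p.1.1, p.1.2, - p.2).

Section sphere_symmetries.
Context (R : realType) (mu : {measure set pt R -> \bar R}) (P : probability (pt R) R).
Hypothesis smu : surface_measure (@sphere2 R) mu.
Hypothesis nmu : normalized mu = P.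

Let i0 : 'I_3 := ord0.
Let i1 : 'I_3 := @Ordinal 3 1 isT.
Let i2 : 'I_3 := @Ordinal 3 2 isT.

Let cx : continuous (fun p : pt R => p.1.1) := @chart_height_continuous R i0.
Let cy : continuous (fun p : pt R => p.1.2) := @chart_height_continuous R i1.
Let cz : continuous (fun p : pt R => p.2) := @chart_height_continuous R i2.

Let mS : measurable (@sphere2 R).
Proof. exact: closed_pt_measurable (@sphere2_closed R). Qed.

Let mH (f : pt R -> R) : continuous f -> measurable [set p | 0 < f p].
Proof.
move=> cf; apply: open_pt_measurable.
by apply: (open_comp (f := f) (D := [set x | 0 < x])) => // ; exact: open_gt.
Qed.

Let transport (k k' : 'I_3) (s s' : R) (T : pt R -> pt R) (A : set (pt R)) :
  s ^+ 2 = 1 -> s' ^+ 2 = 1 -> measurable_fun setT T ->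
  (forall p, chart_proj k' (T p) = chart_proj k p) ->
  (forall p, s' * chart_height k' (T p) = s * chart_height k p) ->
  measurable A -> A `<=` @sphere2 R `&` [set p | 0 < s' * chart_height k' p] ->
  P (T @^-1` A) = P A.
Proof.
move=> s2 s2' mT Tp Th mA AS; rewrite -nmu /normalized.
by congr (_ * _)%E; exact: (sphere_mass_transport smu s2 s2' mT Tp Th mA AS).
Qed.

(** [avg_odd] applies with [D] the open hemisphere of positive [k]-th coordinate. Equatorial points
    are fixed by the reflection, so [g] vanishes there and the equator needs no measure
    computation. *)
Lemma avg_flip (k : 'I_3) (g : pt R -> R) : continuous g ->
  (forall p, g (flip_coord k p) = - g p) -> avg (@sphere2 R) P g = 0.
Proof.
move=> cg gk.
have mT : measurable_fun setT (@flip_coord R k).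
  have cN (f : pt R -> R) : continuous f -> continuous (fun p => - f p).
    by move=> cf p; exact: (cvgN (cf p)).
  rewrite /flip_coord; case: k {gk} => -[|[|[|//]]] ? /=;
    by apply: measurable_pt_fun => //; exact: cN.
have hr p : chart_height k (flip_coord k p) = - chart_height k p.
  by rewrite /flip_coord /chart_height; case: k {gk mT} => -[|[|[|]]].
have pr p : chart_proj k (flip_coord k p) = chart_proj k p.
  by rewrite /flip_coord /chart_proj; case: k {gk mT hr} => -[|[|[|]]].
have Sr (p : pt R) : sphere2 p -> sphere2 (flip_coord k p).
  move=> /(sphereE (@origin R)) Sp; apply/(sphereE (@origin R)); move: Sp.
  rewrite /= !subr0 /flip_coord.
  by case: k {gk mT hr pr} => -[|[|[|//]]] ? /=; rewrite sqrrN.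
have rK p : flip_coord k (flip_coord k p) = p.
  by rewrite /flip_coord; case: k {gk mT hr pr Sr} p => -[|[|[|//]]] ? -[[x y] z] /=; rewrite opprK.
pose D := @sphere2 R `&` [set p | 0 < 1 * chart_height k p].
have mD : measurable D.
  apply: measurableI => //; apply: mH; apply: continuous_pt_mul.
    exact: continuous_pt_cst.
  exact: chart_height_continuous.
apply: (@avg_odd _ _ D _ (@flip_coord R k)) => //.
- exact: sphere2_compact.
- by move=> p [].
- by move=> p [/Sr]; rewrite rK.
- by move=> p [_ /=]; rewrite mul1r => hp [_ /=]; rewrite mul1r hr; lra.
- move=> p Sp nD nD'.
  have h0 : chart_height k p = 0.
    apply/eqP; rewrite eq_le; apply/andP; split; rewrite leNgt; apply/negP => hp.
      by apply: nD; split => //=; rewrite mul1r.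
    by apply: nD'; split => /=; [exact: Sr|rewrite mul1r hr; lra].
  have rp : flip_coord k p = p.
    move: h0; rewrite /flip_coord /chart_height.
    by case: k {gk mT hr pr Sr rK D mD nD nD'} p {Sp} => -[|[|[|//]]] ? -[[x y] z] /= ->; rewrite oppr0.
  by have := gk p; rewrite rp; lra.
- move=> A mA AD; apply: (@transport k k (-1) 1) => //.
  + by rewrite sqrrN expr1n.
  + by rewrite expr1n.
  + by move=> p; rewrite hr mul1r mulN1r.
Qed.

(** [T] exchanges the coordinates [k] and [k'], so the difference of their squares is odd under it;
    this equates two diagonal second moments of the sphere. *)
Lemma avg_swap (k k' : 'I_3) (T : pt R -> pt R) : measurable_fun setT T ->
  (forall p, chart_proj k' (T p) = chart_proj k p) ->
  (forall p, chart_height k' (T p) = chart_height k p) ->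
  (forall p, chart_height k (T p) = chart_height k' p) ->
  (forall p, sphere2 (T p) -> sphere2 p) -> (forall p, sphere2 p -> sphere2 (T p)) ->
  avg (@sphere2 R) P (fun p => chart_height k' p * chart_height k' p +
    (-1) * (chart_height k p * chart_height k p)) = 0.
Proof.
move=> mT Tp Th Th' ST TS.
pose g p := chart_height k' p * chart_height k' p + (-1) * (chart_height k p * chart_height k p) : R.
have cg : continuous g.
  apply: continuous_pt_add; last apply: continuous_pt_mul; last 2 first.
  - exact: continuous_pt_cst.
  - by apply: continuous_pt_mul; exact: chart_height_continuous.
  by apply: continuous_pt_mul; exact: chart_height_continuous.
pose D := @sphere2 R `&` [set p | 0 < g p].
have gT p : g (T p) = - g p by rewrite /g Th Th'; ring.
have mD : measurable D by apply: measurableI => //; exact: mH.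
apply: (@avg_odd _ _ D _ T) => //.
- exact: sphere2_compact.
- by move=> p [].
- by move=> p [/ST].
- by move=> p [_ /= gp] [_ /=]; rewrite gT; lra.
- move=> p Sp nD nD'; apply/eqP; rewrite eq_le; apply/andP; split; rewrite leNgt; apply/negP => gp.
    exact: nD.
  by apply: nD'; split; [exact: TS|rewrite /= gT oppr_gt0].
move=> A mA AD.
(* Transport handles one hemisphere at a time, so [A] is split by the sign of the height along [k'].
   That height is nonzero on [D], where its square exceeds another square. *)
pose B s := A `&` [set p | 0 < s * chart_height k' p].
have mB s : measurable (B s).
  apply: measurableI => //; apply: mH; apply: continuous_pt_mul.
    exact: continuous_pt_cst.
  exact: chart_height_continuous.
have AB : A = B 1 `|` B (-1).
  apply/seteqP; split=> [p Ap|p [[]|[]]//].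
  have [_ /=] := AD p Ap; rewrite /g => gp.
  have [h|h|h] := ltgtP 0 (chart_height k' p).
  - by left; split => //=; rewrite mul1r.
  - by right; split => //=; rewrite mulN1r oppr_gt0.
  - by move: gp; rewrite -h mul0r add0r mulN1r oppr_gt0 -expr2 ltNge sqr_ge0.
have B0 : B 1 `&` B (-1) = set0.
  apply/seteqP; split => // p [[_ /=]]; rewrite mul1r => h [_ /=].
  by rewrite mulN1r oppr_gt0 => /(lt_trans h); rewrite ltxx.
have PB s : s ^+ 2 = 1 -> P (T @^-1` (B s)) = P (B s).
  move=> s2; apply: (@transport k k' s s) => //.
  - by move=> p; rewrite Th.
  - by move=> p [/AD[Sp _] hp]; split.
have mTB s : measurable (T @^-1` (B s)) by rewrite -[X in measurable X]setTI; exact: mT.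
rewrite AB preimage_setU !measureU//; last by rewrite -preimage_setI B0 preimage_set0.
by congr (_ + _)%E; apply: PB; rewrite ?sqrrN expr1n.
Qed.

End sphere_symmetries.

(** Reflections kill the means and the mixed second moments, and coordinate swaps make the three
    diagonal ones equal, hence 1/3 each. The fourth moment is then 2 + 2 + 4 * 3 * (1/3)^2 =
    16/3. *)
Lemma sphere2_moments (R : realType) (mu : {measure set pt R -> \bar R})
    (P : probability (pt R) R) :
  surface_measure (@sphere2 R) mu -> normalized mu = P -> P (~` @sphere2 R) = 0%E ->
  (\int[P \x P]_z (dist3 z.1 z.2 ^+ 2)%:E = 2%:E)%E /\
  (\int[P \x P]_z (dist3 z.1 z.2 ^+ 4)%:E = (16 / 3)%:E)%E.
Proof.
move=> smu nmu PS.
have kS := @sphere2_compact R.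
pose o := @origin R.
pose i0 : 'I_3 := ord0.
pose i1 : 'I_3 := @Ordinal 3 1 isT.
pose i2 : 'I_3 := @Ordinal 3 2 isT.
have cx := @dx_continuous R o; have cy := @dy_continuous R o; have cz := @dz_continuous R o.
have cA := @sqdist_continuous R o.
have flip := avg_flip smu nmu.
pose E := avg (@sphere2 R) P.
have EX : E (dx o) = 0 by apply: (flip i0) => // p; rewrite /dx /flip_coord /=; ring.
have EY : E (dy o) = 0 by apply: (flip i1) => // p; rewrite /dy /flip_coord /=; ring.
have EZ : E (dz o) = 0 by apply: (flip i2) => // p; rewrite /dz /flip_coord /=; ring.
have EXY : E (fun p => dx o p * dy o p) = 0.
  apply: (flip i0) => [|p]; first exact: continuous_pt_mul.
  by rewrite /dx /dy /flip_coord /=; ring.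
have EXZ : E (fun p => dx o p * dz o p) = 0.
  apply: (flip i0) => [|p]; first exact: continuous_pt_mul.
  by rewrite /dx /dz /flip_coord /=; ring.
have EYZ : E (fun p => dy o p * dz o p) = 0.
  apply: (flip i1) => [|p]; first exact: continuous_pt_mul.
  by rewrite /dy /dz /flip_coord /=; ring.
have swap : forall (f g : pt R -> R), continuous f -> continuous g ->
    E (fun p => g p * g p + -1 * (f p * f p)) = 0 ->
    E (fun p => f p * f p) = E (fun p => g p * g p).
  move=> f g cf cg; have cff := continuous_pt_mul cf cf; have cgg := continuous_pt_mul cg cg.
  rewrite /E avgD//; last by apply: continuous_pt_mul => //; exact: continuous_pt_cst.
  rewrite avgZ//; lra.
have cX : continuous (fun p : pt R => p.1.1) := @chart_height_continuous R i0.
have cY : continuous (fun p : pt R => p.1.2) := @chart_height_continuous R i1.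
have cZ : continuous (fun p : pt R => p.2) := @chart_height_continuous R i2.
have dE : [/\ dx o = (fun p => p.1.1), dy o = (fun p => p.1.2) & dz o = snd].
  by split; apply/funext => p; rewrite /dx /dy /dz /= subr0.
have EXXYY : E (fun p => dx o p * dx o p) = E (fun p => dy o p * dy o p).
  apply: swap => //; have [-> -> _] := dE.
  apply: (avg_swap smu nmu (k := i0) (k' := i1) (T := fun p => (p.1.2, p.1.1, p.2))) => //.
  - exact: measurable_pt_fun.
  - by move=> p /(sphereE o) h; apply/(sphereE o); rewrite -h /=; ring.
  - by move=> p /(sphereE o) h; apply/(sphereE o); rewrite -h /=; ring.
have EYYZZ : E (fun p => dy o p * dy o p) = E (fun p => dz o p * dz o p).
  apply: swap => //; have [_ -> ->] := dE.
  apply: (avg_swap smu nmu (k := i1) (k' := i2) (T := fun p => (p.1.1, p.2, p.1.2))) => //.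
  - exact: measurable_pt_fun.
  - by move=> p /(sphereE o) h; apply/(sphereE o); rewrite -h /=; ring.
  - by move=> p /(sphereE o) h; apply/(sphereE o); rewrite -h /=; ring.
have A1 p : sphere2 p -> sqdist o p = 1.
  by move=> /(sphereE o) <-; rewrite /sqdist /dx /dy /dz !expr2.
have EA : E (sqdist o) = 1.
  rewrite -(avg_cst kS PS 1); apply: eq_Rintegral => p; rewrite inE; exact: A1.
have EAA : E (fun p => sqdist o p * sqdist o p) = 1.
  rewrite -(avg_cst kS PS 1); apply: eq_Rintegral => p; rewrite inE => /A1 ->.
  exact: mulr1.
have sumE : E (fun p => dx o p * dx o p) + E (fun p => dy o p * dy o p)
    + E (fun p => dz o p * dz o p) = 1.
  rewrite -EA /E -avgD//; last 2 first; try exact: continuous_pt_mul.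
  rewrite -avgD//; last exact: continuous_pt_mul.
  by apply: continuous_pt_add; exact: continuous_pt_mul.
split.
  by rewrite (dist2_moment kS PS EX EY EZ) -/(E _) EA mulr1.
rewrite (dist4_moment kS PS EX EY EZ) -!/(E _) EA EAA EXY EXZ EYZ; congr EFin.
move: sumE; rewrite EXXYY EYYZZ => sumE.
by rewrite (_ : E _ = 1 / 3); [field|lra].
Qed.

(** * Rigidity of the extremal moments and conclusion *)

Lemma surface_probability (R : realType) (M : set (pt R)) (mu : {measure set pt R -> \bar R}) :
  M !=set0 -> compact M -> surface_measure M mu ->
  (forall p, M p -> exists k U f W, W p /\ is_chart M k U f W) ->
  exists P : probability (pt R) R, [/\ normalized mu = P, P (~` M) = 0%E &
    forall p V, M p -> open V -> V p -> (0 < P V)%E].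
Proof.
move=> [p Mp] kM smu chM.
have cM : closed M by apply: compact_closed => //; exact: pt_hausdorff.
have supp := open_mass_gt0 cM smu chM.
have mu0 : (0 < mu setT)%E by exact: (supp p setT Mp openT).
have muoo := compact_finite_mass cM smu chM kM.
have [P nP] := normalized_probability mu0 muoo.
exists P; split => //.
  by rewrite -nP /normalized smu.1 mul0e.
move=> q V Mq oV Vq; rewrite -nP /normalized; apply: mule_gt0; first exact: supp Mq oV Vq.
by rewrite lte_fin invr_gt0 fine_gt0// mu0.
Qed.

(* At fixed second moment 2 the fourth moment is at least 16 / 3; the variance of the
   squared distance to the mean is the defect in this inequality. *)
Lemma extremal_moments (R : realType) (M : set (pt R)) (P : probability (pt R) R) :
  compact M -> P (~` M) = 0%E ->
  (forall p V, M p -> open V -> V p -> (0 < P V)%E) ->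
  (\int[P \x P]_z (dist3 z.1 z.2 ^+ 2)%:E = 2%:E)%E ->
  (\int[P \x P]_z (dist3 z.1 z.2 ^+ 4)%:E = (16 / 3)%:E)%E ->
  exists c, M `<=` sphere c.
Proof.
move=> kM PM supp.
pose E := avg M P.
pose m : pt R := (E (fun p => p.1.1), E (fun p => p.1.2), E (fun p => p.2)).
have center f : continuous f -> E (fun p => f p - E f) = 0.
  move=> cf; rewrite /E avgD//; last exact: continuous_pt_cst.
  by rewrite (avg_cst kM PM) subrr.
have EX : E (dx m) = 0 by apply: center; exact: (@chart_height_continuous R ord0).
have EY : E (dy m) = 0 by apply: center; exact: (@chart_height_continuous R (@Ordinal 3 1 isT)).
have EZ : E (dz m) = 0 by apply: center; exact: (@chart_height_continuous R (@Ordinal 3 2 isT)).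
have cX := @dx_continuous R m; have cY := @dy_continuous R m; have cZ := @dz_continuous R m.
have cA := @sqdist_continuous R m.
rewrite (dist2_moment kM PM EX EY EZ) (dist4_moment kM PM EX EY EZ) -!/(E _).
have : E (sqdist m) = E (fun p => dx m p * dx m p) + E (fun p => dy m p * dy m p)
    + E (fun p => dz m p * dz m p).
  rewrite /E -avgD//; last 2 first; try exact: continuous_pt_mul.
  rewrite -avgD//; last exact: continuous_pt_mul.
  by apply: continuous_pt_add; exact: continuous_pt_mul.
have : E (fun p => (sqdist m p - 1) ^+ 2) =
    E (fun p => sqdist m p * sqdist m p) - 2 * E (sqdist m) + 1.
  pose l : seq (R * (pt R -> R)) :=
    [:: (1, fun p => sqdist m p * sqdist m p); (- 2, sqdist m); (1, fun=> 1)].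
  have cl : all_continuous l.
    by do !split => //; [exact: continuous_pt_mul|exact: continuous_pt_cst].
  rewrite (_ : (fun p => _) = lincomb l); last first.
    by apply/funext => p; rewrite /lincomb /=; ring.
  by rewrite /E (avg_lincomb kM PM cl).2 /= (avg_cst kM PM); ring.
move: (E (sqdist m)) (E (fun p => sqdist m p * sqdist m p)) (E (fun p => dx m p * dx m p))
  (E (fun p => dy m p * dy m p)) (E (fun p => dz m p * dz m p)) (E (fun p => dx m p * dy m p))
  (E (fun p => dx m p * dz m p)) (E (fun p => dy m p * dz m p)) => s a xx yy zz xy xz yz.
move=> ev es [s2] [s4].
have s1 : s = 1 by lra.
(* With s = 1 the variance is a - 1. Expanding the squares of xx - 1/3, yy - 1/3 and zz - 1/3, where
   xx + yy + zz = 1, bounds the diagonal part below by 1/3, and the fourth moment 16/3 then forces a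
   <= 1. *)
have ev0 : E (fun p => (sqdist m p - 1) ^+ 2) <= 0.
  have tr : 1 / 3 <= xx ^+ 2 + yy ^+ 2 + zz ^+ 2.
    have zzE : zz = 1 - xx - yy by lra.
    have := sqr_ge0 (xx - 1 / 3); have := sqr_ge0 (yy - 1 / 3); have := sqr_ge0 (zz - 1 / 3).
    rewrite !sqrrB; lra.
  have := sqr_ge0 xy; have := sqr_ge0 xz; have := sqr_ge0 yz.
  by rewrite ev; move: s4; rewrite s1; lra.
exists m => p Mp; apply/sphereE.
have cg : continuous (fun p => (sqdist m p - 1) ^+ 2).
  by apply: continuous_pt_mul; apply: continuous_pt_add => //; exact: continuous_pt_cst.
have [gp|gp] := ltP 0 ((sqdist m p - 1) ^+ 2).
  have := avg_gt0 kM PM cg (fun q => sqr_ge0 _) (supp p ^~ Mp) gp.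
  by rewrite ltNge -/(E _) ev0.
have : (sqdist m p - 1) ^+ 2 = 0 by apply/eqP; rewrite eq_le gp sqr_ge0.
by move=> /eqP; rewrite sqrf_eq0 subr_eq0 => /eqP.
Qed.

Theorem theorem5p9 (R : realType) (M : set (pt R))
  (muM muS : {measure set pt R -> \bar R}) :
  closed_smooth_surface M ->
  surface_measure M muM ->
  surface_measure (@sphere2 R) muS ->
  (forall r : R, 0 <= r ->
     global_dist_distr (normalized muM) r = global_dist_distr (normalized muS) r) ->
  exists c : pt R, M = [set p | dist3 p c = 1].
Proof.
move=> sM smM smS eqH; have [M0 [kM [_ chM]]] := sM.
have [P [nP PM supp]] := surface_probability M0 kM smM chM.
have S0 : @sphere2 R !=set0.
  by exists (1, 0, 0); apply/(sphereE (@origin R)); rewrite /=; ring.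
have [Q [nQ QS _]] := surface_probability S0 (@sphere2_compact R) smS (@sphere2_charts R).
rewrite nP nQ in eqH.
have [Q2 Q4] := sphere2_moments smS nQ QS.
have [c Mc] := extremal_moments kM PM supp (etrans (dist_moment_eq eqH 2) Q2)
  (etrans (dist_moment_eq eqH 4) Q4).
by exists c; exact: surface_in_sphere.
Qed.
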